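(* Let $\eta$ be an $H_n$-invariant, log-concave, isotropic probability measure on $\mathbb{R}^n$, and let $f$ be a homogeneous quadratic polynomial on $\mathbb{R}^n$ with $\mathrm{coeff}_2(f)=1$. Then $$\mathbb{E}_\eta[f^2]\ge\frac45+O(n^{-1}),$$ and $$\mathrm{Var}_\eta(f)\ge\min\left(\mathrm{Var}_\eta\left(\frac{1}{\sqrt n}\|x\|_2^2\right),\ \frac45+O(n^{-1})\right),$$ where the constants implied by $O(n^{-1})$ are absolute.
   Context: $\eta$ is $H_n$-invariant if it is invariant under all coordinate permutations and all reflections $x_i\mapsto-x_i$. It is isotropic if centered with identity covariance matrix, and log-concave if absolutely continuous with density $e^{-\varphi}$ for some convex $\varphi:\mathbb{R}^n\to(-\infty,\infty]$. For $f=\sum_{|I|=2}\alpha_Ix^I$, $\mathrm{coeff}_2(f)=\sqrt{\sum_{|I|=2}\alpha_I^2}$. *)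

(* Defs.v *)
From HB Require Import structures.
From mathcomp Require Import all_boot all_order all_algebra all_fingroup.
From mathcomp Require Import all_classical all_reals all_analysis.
From mathcomp Require Import measurable_realfun.
(* The notations and names of mpoly clash with those of mathcomp-analysis, so
   only its canonical structures and coercions are imported. *)
From mathcomp.multinomials Require mpoly.
Import (canonicals, coercions) mpoly.

Set Implicit Arguments.
Unset Strict Implicit.
Unset Printing Implicit Defensive.

Import Order.TTheory GRing.Theory Num.Theory.
Import numFieldNormedType.Exports.

Local Open Scope classical_set_scope.
Local Open Scope ring_scope.

(* R^n is modelled as n.-tuple R with the product sigma-algebra generated by
   the coordinates, i.e. the Borel sigma-algebra. *)
Notation Rn R n := (n.-tuple (measurableTypeR R)).

Section Lebesgue.
Variable R : realType.

Definition consRn (n : nat) (p : measurableTypeR R * Rn R n) : Rn R n.+1 :=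
  [tuple of p.1 :: p.2].

Lemma measurable_consRn (n : nat) : measurable_fun [set: _] (@consRn n).
Proof. by apply: measurable_cons. Qed.

Section step.
Variables (n : nat) (nu : {sigma_finite_measure set (Rn R n) -> \bar R}).

Definition leb_step : set (Rn R n.+1) -> \bar R :=
  pushforward (@lebesgue_measure R \x nu)%E (@consRn n).

Let leb_step0 : leb_step set0 = 0%E.
Proof. by rewrite /leb_step /pushforward preimage_set0 measure0. Qed.

Let leb_step_ge0 A : (0 <= leb_step A)%E.
Proof. by rewrite /leb_step /pushforward. Qed.

Let leb_step_sigma_additive : semi_sigma_additive leb_step.
Proof.
move=> F mF tF mUF; rewrite /leb_step /pushforward preimage_bigcup.
have mpre A : measurable A -> measurable (@consRn n @^-1` A).
  by move=> mA; rewrite -[X in measurable X]setTI; exact: measurable_consRn.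
apply: measure_semi_sigma_additive.
- by move=> i; exact: mpre.
- apply/trivIsetP => /= i j _ _ ij; rewrite -preimage_setI.
  by move/trivIsetP : tF => /(_ _ _ _ _ ij) ->//; rewrite preimage_set0.
- by rewrite -preimage_bigcup; exact: mpre.
Qed.

HB.instance Definition _ := isMeasure.Build _ _ _
  leb_step leb_step0 leb_step_ge0 leb_step_sigma_additive.

Let sigma_finite_leb_step : sigma_finite [set: _] leb_step.
Proof.
have /sigma_finiteP[F [FT Fnd Foo]] := sigma_finiteT (@lebesgue_measure R).
have /sigma_finiteP[G [GT Gnd Goo]] := sigma_finiteT nu.
pose unc (x : Rn R n.+1) : measurableTypeR R * Rn R n :=
  (thead x, [tuple of behead x]).
have munc : measurable_fun [set: _] unc.
  apply: measurable_fun_pair; last exact: measurable_behead.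
  exact: (@measurable_tnth _ (measurableTypeR R)).
exists (fun i => unc @^-1` (F i `*` G i)).
  rewrite -preimage_bigcup (_ : \bigcup_i _ = setT) ?preimage_setT//.
  rewrite -setXTT FT GT predeqE => -[x y]; split.
    by move=> [i _ [/= Fx Gy]]; split; exists i.
  move=> [/= [i _ Fx] [j _ Gy]]; exists (maxn i j) => //; split.
    by move: x Fx; exact/subsetPset/Fnd/leq_maxl.
  by move: y Gy; exact/subsetPset/Gnd/leq_maxr.
move=> i; have [mF F_oo] := Foo i; have [mG G_oo] := Goo i; split.
  by rewrite -[X in measurable X]setTI; apply: munc => //; exact: measurableX.
rewrite /leb_step /pushforward -comp_preimage.
rewrite (_ : unc \o _ = id) ?preimage_id; last first.
  by apply/funext => -[a t] /=; congr (_, _); apply: val_inj.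
by rewrite product_measure1E// lte_mul_pinfty// ge0_fin_numE.
Qed.

HB.instance Definition _ :=
  Measure_isSigmaFinite.Build _ _ _ leb_step sigma_finite_leb_step.
End step.

(* Lebesgue measure on R^n: point mass on R^0, and on R^(n+1) the image of
   lebesgue_measure \x lebesgueRn n under (a, t) |-> a :: t. *)
Fixpoint lebesgueRn (n : nat) : {sigma_finite_measure set (Rn R n) -> \bar R} :=
  match n with
  | 0 => \d_([tuple] : Rn R 0)
  | m.+1 => leb_step (lebesgueRn m)
  end.
End Lebesgue.

Section Definitions.
Variable R : realType.
Implicit Types n : nat.

Definition permRn n (s : 'S_n) (x : Rn R n) : Rn R n :=
  [tuple tnth x (s i) | i < n].

Definition reflRn n (i : 'I_n) (x : Rn R n) : Rn R n :=
  [tuple if j == i then - tnth x j else tnth x j | j < n].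

(* H_n is the group generated by the coordinate permutations and reflections. *)
Definition Hn_invariant n (eta : probability (Rn R n) R) : Prop :=
  (forall (s : 'S_n) (A : set (Rn R n)), measurable A ->
     pushforward eta (permRn s) A = eta A) /\
  (forall (i : 'I_n) (A : set (Rn R n)), measurable A ->
     pushforward eta (reflRn i) A = eta A).

Definition isotropic n (eta : probability (Rn R n) R) : Prop :=
  (forall i : 'I_n, ('E_eta[fun x : Rn R n => tnth x i] = 0)%E) /\
  (forall i j : 'I_n,
     covariance eta (fun x : Rn R n => tnth x i) (fun x : Rn R n => tnth x j)
     = ((i == j)%:R)%:E).

Definition convRn n (t : R) (x y : Rn R n) : Rn R n :=
  [tuple t * tnth x i + (1 - t) * tnth y i | i < n].

(* As phi avoids -oo, the sum is never of the form +oo - oo; also 0 * +oo = 0. *)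
Definition econvex n (phi : Rn R n -> \bar R) : Prop :=
  forall (x y : Rn R n) (t : R), 0 <= t <= 1 ->
    (phi (convRn t x y) <= t%:E * phi x + (1 - t)%:E * phi y)%E.

(* A density is measurable by definition. This excludes no measure eta: changing
   a convex phi on the (null) boundary of its domain makes it semicontinuous. *)
Definition log_concave n (eta : probability (Rn R n) R) : Prop :=
  exists phi : Rn R n -> \bar R,
    [/\ forall x, phi x <> -oo%E,
        econvex phi,
        measurable_fun [set: Rn R n] (fun x => expeR (- phi x)%E) &
        forall A : set (Rn R n), measurable A ->
          (eta A = \int[lebesgueRn R n]_(x in A) expeR (- phi x))%E].

Definition norm2 n (x : Rn R n) : R := Num.sqrt (\sum_(i < n) tnth x i ^+ 2).

Definition homogeneous n (d : nat) (f : mpoly.mpoly n R) : Prop :=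
  f \is mpoly.ishomog1 d (@mpoly.mdeg n).

(* coeff_d of a homogeneous polynomial of degree d: I ranges over the exponents
   with |I| = d, taken in the finite type of exponents of degree < d.+1. *)
Definition coeff n (d : nat) (f : mpoly.mpoly n R) : R :=
  Num.sqrt (\sum_(I : mpoly.bmultinom n d.+1 | mpoly.mdeg I == d)
              mpoly.mcoeff I f ^+ 2).

Definition evalRn n (f : mpoly.mpoly n R) (x : Rn R n) : R :=
  mpoly.meval (tnth x) f.

End Definitions.

(* Main.v *)
Require Import Defs.
From mathcomp Require Import all_boot all_order all_algebra all_fingroup.
From mathcomp Require Import all_classical all_reals all_analysis.
From mathcomp Require Import measurable_realfun ring lra zify.
From mathcomp.multinomials Require mpoly ssrcomplements.
Import (canonicals, coercions) mpoly.

Set Implicit Arguments.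
Unset Strict Implicit.
Unset Printing Implicit Defensive.

Import Order.TTheory GRing.Theory Num.Theory.
Import numFieldNormedType.Exports.

Local Open Scope classical_set_scope.
Local Open Scope ring_scope.

(** Symmetry leaves only two fourth moments of [eta]: m4 = E x_0^4 and
    m22 = E x_0^2 x_1^2.  Write f = sum_(i <= j) c_ij x_i x_j, and let A and B
    be the sums of the squares of the diagonal and of the off-diagonal
    coefficients, so that A + B = 1, and S = sum_i c_ii = E f.  Then
      E f^2 = (m4 - m22) A + m22 S^2 + m22 B,
      Var f = (m4 - m22) (A - S^2 / n) + V S^2 / n + m22 B,
    where V is the variance of |x|^2 / sqrt n.  As S^2 <= n A, the second line
    is a convex combination of m4 - m22, V and m22.  Hence both claims follow
    from m4 - m22 >= 4/5 and m22 >= 1 - O(1/n).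

    First inequality ([mom4_sub_mom22_ge]).  As E x_0^2 = 1, it is equivalent to
    E psi (x_0, x_1) >= 0 for psi x y = 5 (x^2 - y^2)^2 - 8 (x^2 + y^2) + 8.
    Given the other coordinates, the law of (x_0, x_1) has a symmetric density
    that is nonincreasing in |x_0| and in |x_1|, and among all such laws the
    extremal one is uniform on the square of side 2 sqrt 3, for which
    E psi = 0.  To see that it is extremal, let M be the larger of |x_0|, |x_1|.
    Given M, the smaller one has a nonincreasing density on [0, M], where psi is
    first above and then below its mean [psi_mean M] for the uniform law, so psi
    may be replaced by [psi_mean M] = 8/3 (M^2 - 1) (M^2 - 3).  The expectation
    of the latter is nonnegative by the same comparison, once it is split into
    functions of x_0 and of x_1 that are integrated along lines
    ([psi_split], [crossing_psi_min], [crossing_psi_max]).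

    Second inequality ([mom22_ge]).  V >= 0 reads m4 + (n - 1) m22 >= n, so it
    suffices that m4 = O(m22).  This fails for laws that are merely unimodal in
    each coordinate, since these may concentrate near the axes; it follows from
    unimodality of the density along the lines x_0 + x_1 = const ([mom4_le]).

    All comparisons on lines are instances of [single_crossing].  The lines lie
    in the directions e_0 and e_0 - e_1, and Fubini's theorem for the density
    rho = exp (- phi) of [eta] integrates the inequalities over R^n.  Unimodality
    on lines comes from the convexity of phi in the form
    rho (s x + (1 - s) y) >= min (rho x) (rho y).

    The fourth moments of [eta] are not known to be finite in advance.  The
    moment inequalities are therefore proved for the restrictions of [eta] to
    the boxes [-k, k]^n, which have the same symmetries and quasiconcave
    densities, but whose mass m0 and second moment m2 only tend to 1.  Monotone
    convergence then gives the result. *)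

(** * Lebesgue measure on R^n *)

Section lebesgue_line.
Local Open Scope ereal_scope.
Variable R : realType.
Local Notation leb := (@lebesgue_measure R).
Implicit Types F : measurableTypeR R -> \bar R.

Lemma ge0_integral_lebesgueN F :
  measurable_fun setT F -> (forall x, 0 <= F x) ->
  \int[leb]_x F (- x)%R = \int[leb]_x F x.
Proof.
move=> mF F0.
have mN : measurable_fun setT (-%R : measurableTypeR R -> measurableTypeR R).
  exact: oppr_measurable.
transitivity (\int[pushforward leb (-%R : measurableTypeR R -> measurableTypeR R)]_x F x).
  by rewrite ge0_integral_pushforward//= preimage_setT.
by apply: eq_measure_integral => //= A mA _; exact: lebesgue_measureN.
Qed.

Lemma ge0_integral_lebesgueD F (s : R) :
  measurable_fun setT F -> (forall x, 0 <= F x) ->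
  \int[leb]_x F (x + s)%R = \int[leb]_x F x.
Proof.
move=> mF F0.
pose sh : measurableTypeR R -> measurableTypeR R := fun x => (x + s)%R.
have mS : measurable_fun setT sh by exact: measurable_funD.
transitivity (\int[pushforward leb sh]_x F x).
  by rewrite ge0_integral_pushforward//= preimage_setT.
apply: eq_measure_integral => //= A mA _; apply/esym.
apply: lebesgue_measure_unique => //= _ [[a b]] _ <-.
rewrite /pushforward (_ : _ @^-1` _ = `](a - s)%R, (b - s)%R]%classic).
  rewrite !lebesgue_measure_itv/= !lte_fin ltrD2r.
  by case: ifPn => // _; rewrite -!EFinD; congr EFin; lra.
by apply/seteqP; split => x /=; rewrite /sh !in_itv/=; lra.
Qed.

End lebesgue_line.

Section lebesgueRn.
Local Open Scope ereal_scope.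
Variable R : realType.
Local Notation leb := (@lebesgue_measure R).

Definition Rn_cons n (a : measurableTypeR R) (t : Rn R n) : Rn R n.+1 :=
  consRn (a, t).

Lemma measurable_Rn_cons n d (X : measurableType d) (f : X -> measurableTypeR R)
    (g : X -> Rn R n) :
  measurable_fun setT f -> measurable_fun setT g ->
  measurable_fun setT (fun x => Rn_cons (f x) (g x)).
Proof. by move=> mf mg; apply: measurable_cons. Qed.

Lemma ge0_integral_lebesgueRnS n (F : Rn R n.+1 -> \bar R) :
  measurable_fun setT F -> (forall x, 0 <= F x) ->
  \int[lebesgueRn R n.+1]_x F x =
  \int[lebesgueRn R n]_t \int[leb]_a F (Rn_cons a t).
Proof.
move=> mF F0.
transitivity (\int[pushforward (leb \x lebesgueRn R n) (@consRn R n)]_x F x).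
  by apply: eq_measure_integral; first exact: measurable_consRn.
have mc : measurable_fun setT (@consRn R n) by exact: measurable_consRn.
rewrite ge0_integral_pushforward//= preimage_setT.
rewrite (fubini_tonelli2 (F \o @consRn R n)) => [|//|x /=]; last exact: F0.
  by [].
exact: (measurableT_comp mF mc).
Qed.

Lemma ge0_integral_lebesgueRnSS n (F : Rn R n.+2 -> \bar R) :
  measurable_fun setT F -> (forall x, 0 <= F x) ->
  \int[lebesgueRn R n.+2]_x F x =
  \int[lebesgueRn R n]_t \int[leb]_b \int[leb]_a F (Rn_cons a (Rn_cons b t)).
Proof.
move=> mF F0; rewrite ge0_integral_lebesgueRnS// ge0_integral_lebesgueRnS//.
  apply: (@measurable_fun_fubini_tonelli_G _ _ (measurableTypeR R) _ _ leb
    (fun p => F (consRn p))) => //.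
  by apply: measurableT_comp => //; exact: measurable_consRn.
by move=> x; exact: integral_ge0.
Qed.

(** [lebesgueRn] integrates the first coordinate innermost; the invariance of
    the measure under the exchange of the first two coordinates, and the changes
    of variables that mix them, require the other order. *)
Lemma ge0_integral_lebesgueRnSSC n (F : Rn R n.+2 -> \bar R) :
  measurable_fun setT F -> (forall x, 0 <= F x) ->
  \int[lebesgueRn R n.+2]_x F x =
  \int[lebesgueRn R n]_t \int[leb]_a \int[leb]_b F (Rn_cons a (Rn_cons b t)).
Proof.
move=> mF F0; rewrite (ge0_integral_lebesgueRnSS mF F0).
apply: eq_integral => t _.
apply/esym.
pose f (p : measurableTypeR R * measurableTypeR R) := F (Rn_cons p.1 (Rn_cons p.2 t)).
have mf : measurable_fun setT f.
  apply: (measurableT_comp mF); apply: measurable_Rn_cons; first exact: measurable_fst.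
  by apply: measurable_Rn_cons; [exact: measurable_snd|exact: measurable_cst].
exact: (fubini_tonelli (m1 := leb) (m2 := leb) f mf (fun=> F0 _)).
Qed.

End lebesgueRn.

(** * Densities *)

Section density.
Local Open Scope ereal_scope.
Context d (T : measurableType d) (R : realType).
Variables (mu nu : {measure set T -> \bar R}) (rho : T -> R).
Hypothesis mrho : measurable_fun setT rho.
Hypothesis rho0 : forall x, (0 <= rho x)%R.
Hypothesis nuE : forall A, measurable A -> nu A = \int[mu]_(x in A) (rho x)%:E.

Import HBNNSimple.

Lemma ge0_integral_density (F : T -> \bar R) :
  measurable_fun setT F -> (forall x, 0 <= F x) ->
  \int[nu]_x F x = \int[mu]_x (F x * (rho x)%:E).
Proof.
move=> mF F0; pose h := nnsfun_approx measurableT mF.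
have mr : measurable_fun setT (fun x => (rho x)%:E) by exact/measurable_EFinP.
have hF x : (EFin \o h n) x @[n --> \oo] --> F x by exact: cvg_nnsfun_approx.
transitivity (limn (fun n => \int[nu]_x (h n x)%:E)).
  rewrite -monotone_convergence//.
  - by apply: eq_integral => x _; apply/esym/cvg_lim => //; exact: hF.
  - by move=> n; exact/measurable_EFinP.
  - by move=> n x _; rewrite lee_fin.
  - by move=> x _ a b ab; rewrite lee_fin; exact/lefP/nd_nnsfun_approx.
transitivity (limn (fun n => \int[mu]_x ((h n x)%:E * (rho x)%:E))); last first.
  rewrite -monotone_convergence//.
  - apply: eq_integral => x _; apply/cvg_lim => //.
    by apply: cvgeZr => //; exact: hF.
  - by move=> n; apply: emeasurable_funM => //; exact/measurable_EFinP.
  - by move=> n x _; rewrite mule_ge0 ?lee_fin.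
  - move=> x _ a b ab; rewrite lee_wpmul2r ?lee_fin//.
    exact/lefP/nd_nnsfun_approx.
congr (limn _); apply/funext => n.
under eq_integral do rewrite fimfunE -fsumEFin//.
under [RHS]eq_integral.
  move=> x _; rewrite fimfunE -fsumEFin// ge0_mule_fsuml; last first.
    by move=> y; exact: nnfun_muleindic_ge0.
  over.
rewrite ge0_integral_fsum//; last 2 first.
  - by move=> y; exact/measurable_EFinP/measurable_funM.
  - by move=> y x _; exact: nnfun_muleindic_ge0.
rewrite ge0_integral_fsum//; last 2 first.
  - move=> y; apply: emeasurable_funM => //.
    exact/measurable_EFinP/measurable_funM.
  - by move=> y x _; rewrite mule_ge0 ?lee_fin//; exact: nnfun_muleindic_ge0.
apply: eq_fsbigr => r rhn.
have r0 : (0 <= r)%R by move: rhn; rewrite inE => -[t _ <-].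
rewrite integralZl_indic_nnsfun// integral_indic// setIT nuE//.
under [RHS]eq_integral do rewrite EFinM -muleA.
rewrite ge0_integralZl//; last first.
- by move=> x _; rewrite mule_ge0 ?lee_fin.
- apply: emeasurable_funM => //; exact/measurable_EFinP.
congr (_ * _); under [RHS]eq_integral do rewrite muleC.
rewrite integral_mkcond; apply: eq_integral => x _.
by rewrite epatch_indic.
Qed.

End density.

(** * Integrals of a sign-changing function against a unimodal density *)

Section line.
Local Open Scope ereal_scope.
Variable R : realType.
Local Notation leb := (@lebesgue_measure R).
Local Notation mR := (measurableTypeR R).

(** The integrands met below are even polynomials of degree at most 4, so this
    is the only primitive that has to be computed. *)
Lemma integral_even_quartic (a0 a1 a2 c : R) : (0 <= c)%R ->
  \int[leb]_(x in `[(- c)%R, c]) (a0 + a1 * x ^+ 2 + a2 * x ^+ 4)%:E =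
  ((a0 * c + a1 * c ^+ 3 / 3 + a2 * c ^+ 5 / 5) *+ 2)%:E.
Proof.
rewrite le_eqVlt => /predU1P[<-|c0].
  by rewrite oppr0 set_itv1 integral_set1 !expr0n/= !(mulr0, mul0r, addr0) mul0rn.
pose P : {poly R} := (a0 *: 'X + (a1 / 3) *: 'X^3 + (a2 / 5) *: 'X^5)%R.
have PE x : P^`().[x] = (a0 + a1 * x ^+ 2 + a2 * x ^+ 4)%R.
  rewrite /P !(derivD, derivZ, derivXn, derivX) !hornerE /=.
  by field.
under eq_integral do rewrite -PE.
rewrite (@continuous_FTC2 _ (horner P^`()) (horner P)).
- rewrite -EFinB /P !hornerE /=; congr EFin; rewrite mulr2n.
  by field.
- by rewrite gtrN.
- by apply: continuous_subspaceT; exact: continuous_horner.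
- split.
  + by move=> x _; exact: derivable_horner.
  + by apply: cvg_at_right_filter; exact: continuous_horner.
  + by apply: cvg_at_left_filter; exact: continuous_horner.
- by move=> x _; rewrite -derivE.
Qed.

Lemma integral_neg_le_pos (D : set mR) (g : R -> R) :
  measurable D -> measurable_fun D g ->
  \int[leb]_(x in D) (Num.max (- g x) 0)%:E < +oo ->
  0 <= \int[leb]_(x in D) (g x)%:E ->
  \int[leb]_(x in D) (Num.max (- g x) 0)%:E <=
  \int[leb]_(x in D) (Num.max (g x) 0)%:E.
Proof.
move=> mD mg fin; rewrite integralE.
have -> : \int[leb]_(x in D) (fun x => (g x)%:E)^\+ x =
    \int[leb]_(x in D) (Num.max (g x) 0)%:E.
  by apply: eq_integral => x _; rewrite funeposE EFin_max.
have -> : \int[leb]_(x in D) (fun x => (g x)%:E)^\- x =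
    \int[leb]_(x in D) (Num.max (- g x) 0)%:E.
  by apply: eq_integral => x _; rewrite funenegE -EFinN EFin_max.
rewrite sube_ge0//; apply/orP; left.
rewrite ge0_fin_numE//;
apply: integral_ge0 => x _.
by rewrite lee_fin le_max lexx orbT.
Qed.

(** On [-c, c] the function [g] is nonnegative up to [s] and nonpositive from [s]
    on, so replacing the nonincreasing weight [r] by its value at [s] can only
    decrease the integral of [g * r] there; outside [-c, c] nothing negative is
    left.  The conclusion compares positive and negative parts, so that it makes
    sense without integrability and can be integrated over the lines by
    Tonelli's theorem. *)
Lemma single_crossing (g r : R -> R) (s c : R) :
  measurable_fun setT g -> measurable_fun setT r ->
  (forall x, 0 <= r x)%R ->
  (forall x y, `|x| <= `|y| -> r y <= r x)%R ->
  (0 <= s)%R ->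
  (forall x, g x < 0 -> s <= `|x| <= c)%R ->
  (forall x, 0 < g x -> `|x| <= c -> `|x| <= s)%R ->
  \int[leb]_(x in `[(- c)%R, c]) (Num.max (- g x) 0)%:E <=
    \int[leb]_(x in `[(- c)%R, c]) (Num.max (g x) 0)%:E ->
  \int[leb]_x (Num.max (- g x) 0 * r x)%:E <=
  \int[leb]_x (Num.max (g x) 0 * r x)%:E.
Proof.
move=> mg mr r0 rmono s0 gneg gpos gint.
have mneg : measurable_fun setT (fun x => Num.max (- g x) 0)%R.
  by apply: measurable_maxr => //; exact: measurableT_comp.
have mpos : measurable_fun setT (fun x => Num.max (g x) 0)%R.
  exact: measurable_maxr.
have max0 (x : R) : (0 <= Num.max x 0)%R by rewrite le_max lexx orbT.
have mI : measurable (`[(- c)%R, c]%classic : set mR) by [].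
have absc (x : R) : `[(- c)%R, c]%classic x <-> (`|x| <= c)%R.
  by rewrite /= in_itv/= ler_norml.
apply: (@le_trans _ _ ((r s)%:E *
    \int[leb]_(x in `[(- c)%R, c]) (Num.max (- g x) 0)%:E)).
  rewrite -ge0_integralZl//; last 3 first.
  - by apply: measurable_funTS; exact/measurable_EFinP.
  - by move=> x _; rewrite lee_fin.
  - by rewrite lee_fin.
  rewrite [leRHS]integral_mkcond; apply: ge0_le_integral => //.
  - by move=> x _; rewrite lee_fin mulr_ge0.
  - by apply/measurable_EFinP; exact: measurable_funM.
  - apply/(measurable_restrictT _ _).1 => //; apply: measurable_funTS.
    by apply: measurable_funeM; exact/measurable_EFinP.
  move=> x _; have [gx|gx] := ltP (g x) 0%R; last first.
    by rewrite max_r ?oppr_le0// mul0r erestrict_ge0// => y _; rewrite mule_ge0 ?lee_fin.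
  have /andP[sx xc] := gneg _ gx.
  rewrite patchE mem_set; last exact/absc.
  rewrite -EFinM lee_fin mulrC ler_wpM2r// rmono//.
  by rewrite (ger0_norm s0).
apply: (@le_trans _ _ ((r s)%:E *
    \int[leb]_(x in `[(- c)%R, c]) (Num.max (g x) 0)%:E)).
  by rewrite lee_wpmul2l ?lee_fin.
rewrite -ge0_integralZl//; last 3 first.
- by apply: measurable_funTS; exact/measurable_EFinP.
- by move=> x _; rewrite lee_fin.
- by rewrite lee_fin.
rewrite [leLHS]integral_mkcond; apply: ge0_le_integral => //.
- by move=> x _; rewrite erestrict_ge0// => y _; rewrite mule_ge0 ?lee_fin.
- apply/(measurable_restrictT _ _).1 => //; apply: measurable_funTS.
  by apply: measurable_funeM; exact/measurable_EFinP.
- by apply/measurable_EFinP; exact: measurable_funM.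
move=> x _; rewrite patchE; case: ifPn => [|_]; last by rewrite lee_fin mulr_ge0.
rewrite inE => /absc xc; rewrite -EFinM lee_fin.
have [gx|gx] := ltP 0%R (g x); last by rewrite mulr0 mul0r.
by rewrite mulrC ler_wpM2l ?(ltW gx)// rmono// (ger0_norm s0) gpos.
Qed.

End line.

(** * Symmetrized densities *)

Section symmetrize.
Local Open Scope ereal_scope.
Context d (T : measurableType d) (R : realType).
Variables (mu nu : {measure set T -> \bar R}) (rho : T -> R) (g : T -> T).
Hypothesis mrho : measurable_fun setT rho.
Hypothesis rho0 : forall x, (0 <= rho x)%R.
Hypothesis nuE : forall A, measurable A -> nu A = \int[mu]_(x in A) (rho x)%:E.
Hypothesis mg : measurable_fun setT g.
Hypothesis gK : involutive g.
Hypothesis mug : forall F : T -> \bar R, measurable_fun setT F ->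
  (forall x, 0 <= F x) -> \int[mu]_x F (g x) = \int[mu]_x F x.
Hypothesis nug : forall A, measurable A -> nu (g @^-1` A) = nu A.

(** A measure invariant under [g] has a density that is [g]-invariant only almost
    everywhere.  Since [rho] and [rho \o g] are both densities, so is their
    minimum: on the part of [A] where [rho <= rho \o g] use the first, on the rest
    the second.  The minimum is invariant at every point and is still
    quasiconcave when [g] is affine. *)
Lemma density_min_involution A : measurable A ->
  nu A = \int[mu]_(x in A) (Num.min (rho x) (rho (g x)))%:E.
Proof.
move=> mA.
have mrg : measurable_fun setT (rho \o g) by exact: measurableT_comp.
have mmin : measurable_fun setT (fun x => Num.min (rho x) (rho (g x))).
  exact: measurable_minr.
pose D := [set x | (rho x <= rho (g x))%R].
have mD : measurable D.
  have := measurable_fun_ler mrho mrg => /(_ measurableT [set true]).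
  by rewrite setTI; exact.
have mAD : measurable (A `&` D) by exact: measurableI.
have mAnD : measurable (A `\` D) by exact: measurableD.
have dis : (A `&` D) `&` (A `\` D) = set0.
  by apply/seteqP; split => // x [[_ ?] [_ ?]].
have AE : A = (A `&` D) `|` (A `\` D) by rewrite setUIDK.
have -> : nu A = nu (A `&` D) + nu (A `\` D).
  by rewrite [in LHS]AE measureU.
rewrite [in RHS]AE ge0_integral_setU//; last 3 first.
- by rewrite -AE; apply: measurable_funTS; exact/measurable_EFinP.
- by move=> x _; rewrite lee_fin le_min !rho0.
- exact/disj_set2P.
congr (_ + _).
  rewrite nuE//; apply: eq_integral => x; rewrite inE => -[_ /= h].
  by rewrite min_l.
rewrite -nug// nuE; last by rewrite -[X in measurable X]setTI; exact: mg.
rewrite integral_mkcond.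
rewrite (_ : _ \_ _ = (fun x => ((fun y => (rho (g y))%:E) \_ (A `\` D)) (g x))).
  rewrite mug//; last 2 first.
  - apply/(measurable_restrictT _ _).1 => //; apply: measurable_funTS.
    exact/measurable_EFinP.
  - by move=> x; rewrite erestrict_ge0// => y _; rewrite lee_fin.
  rewrite -integral_mkcond; apply: eq_integral => x; rewrite inE => -[_ /= h].
  by rewrite min_r// ltW// ltNge; exact/negP.
apply/funext => x; rewrite !patchE gK.
by congr (if _ then _ else _); apply/idP/idP; rewrite !inE.
Qed.

End symmetrize.

Section quasiconcave_line.
Variable R : realType.

Lemma even_quasiconcave_nonincreasing (r : R -> R) :
  (forall x, r (- x) = r x) ->
  (forall t x y, 0 <= t <= 1 ->
     Num.min (r x) (r y) <= r (t * x + (1 - t) * y)) ->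
  forall x y, `|x| <= `|y| -> r y <= r x.
Proof.
move=> ev qc x y; have [->|y0] := eqVneq y 0.
  by rewrite normr0 normr_le0 => /eqP ->.
move=> xy; have y0' : 0 < `|y| by rewrite normr_gt0.
have rabs z : r `|z| = r z by case: (ger0P z) => // _; rewrite ev.
rewrite -(rabs y).
have := qc ((`|y| + x) / (2 * `|y|)) `|y| (- `|y|).
rewrite ev minxx.
have -> : (`|y| + x) / (2 * `|y|) * `|y| + (1 - (`|y| + x) / (2 * `|y|)) * - `|y| = x.
  by field; rewrite lt0r_neq0.
apply; move: xy; rewrite ler_norml => /andP[yx xy].
by rewrite divr_ge0 ?ler_pdivrMr ?mulr_gt0//; nra.
Qed.

End quasiconcave_line.

(** * Lines in R^n *)

Section crossing.
Local Open Scope ereal_scope.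
Variable R : realType.
Local Notation leb := (@lebesgue_measure R).
Local Notation mR := (measurableTypeR R).

(** The hypotheses on [g] in [single_crossing]. *)
Definition crossing (g : R -> R) := exists s c : R,
  [/\ (0 <= s)%R,
      (forall x, g x < 0 -> s <= `|x| <= c)%R,
      (forall x, 0 < g x -> `|x| <= c -> `|x| <= s)%R &
      \int[leb]_(x in `[(- c)%R, c]) (Num.max (- g x) 0)%:E <=
        \int[leb]_(x in `[(- c)%R, c]) (Num.max (g x) 0)%:E].

Variable n : nat.
Implicit Types (a b : mR) (t : Rn R n).

Lemma tnth_Rn_cons0 m a (u : Rn R m) : tnth (Rn_cons a u) ord0 = a.
Proof. by []. Qed.

Lemma tnth_Rn_consS m a (u : Rn R m) i : tnth (Rn_cons a u) (lift ord0 i) = tnth u i.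
Proof. by rewrite /Rn_cons /consRn /= tnthS. Qed.

Lemma tnth_Rn_cons1 a b t : tnth (Rn_cons a (Rn_cons b t)) (lift ord0 ord0) = b.
Proof. by rewrite tnth_Rn_consS. Qed.

Lemma conv_Rn_cons m (s : R) a b (u v : Rn R m) :
  convRn s (Rn_cons a u) (Rn_cons b v) = Rn_cons (s * a + (1 - s) * b)%R (convRn s u v).
Proof.
apply: eq_from_tnth => i; rewrite tnth_mktuple.
by case: (unliftP ord0 i) => [j ->|->]; rewrite ?tnth_Rn_consS ?tnth_mktuple.
Qed.

Lemma convRnxx m (s : R) (u : Rn R m) : convRn s u u = u.
Proof.
by apply: eq_from_tnth => i; rewrite tnth_mktuple; ring.
Qed.

Lemma reflRn0 m a (u : Rn R m) : reflRn ord0 (Rn_cons a u) = Rn_cons (- a)%R u.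
Proof.
apply: eq_from_tnth => i; rewrite tnth_mktuple.
by case: (unliftP ord0 i) => [j ->|->]; rewrite ?tnth_Rn_consS.
Qed.

Lemma reflRnK m (i : 'I_m) : involutive (@reflRn R m i).
Proof.
move=> x; apply: eq_from_tnth => j; rewrite !tnth_mktuple.
by case: (j == i) => //; exact: opprK.
Qed.

Lemma permRn_swap a b t :
  permRn (tperm ord0 (lift ord0 ord0)) (Rn_cons a (Rn_cons b t)) = Rn_cons b (Rn_cons a t).
Proof.
apply: eq_from_tnth => i; rewrite tnth_mktuple.
case: (unliftP ord0 i) => [j ->|->]; last by rewrite tpermL tnth_Rn_cons1.
case: (unliftP ord0 j) => [k ->|->]; last by rewrite tpermR tnth_Rn_cons1.
by rewrite tpermD -?val_eqE//= !tnth_Rn_consS.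
Qed.

Lemma permRnK m (i j : 'I_m) : involutive (@permRn R m (tperm i j)).
Proof.
by move=> x; apply: eq_from_tnth => k; rewrite !tnth_mktuple tpermK.
Qed.

Lemma measurable_reflRn m (i : 'I_m) : measurable_fun setT (@reflRn R m i).
Proof.
apply/measurable_fun_tnthP => j.
rewrite (_ : _ \o _ = fun x : Rn R m => if j == i then - tnth x j else tnth x j)%R; last first.
  by apply/funext => x /=; rewrite tnth_mktuple.
case: (j == i); last exact: measurable_tnth.
by apply: measurableT_comp; [exact: oppr_measurable|exact: measurable_tnth].
Qed.

Lemma measurable_permRn m (s : 'S_m) : measurable_fun setT (@permRn R m s).
Proof.
apply/measurable_fun_tnthP => j.
rewrite (_ : _ \o _ = fun x : Rn R m => tnth x (s j)); last first.
  by apply/funext => x /=; rewrite tnth_mktuple.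
exact: measurable_tnth.
Qed.

Lemma convRn_reflRn m (i : 'I_m) (s : R) (x y : Rn R m) :
  reflRn i (convRn s x y) = convRn s (reflRn i x) (reflRn i y).
Proof.
apply: eq_from_tnth => j; rewrite !tnth_mktuple.
by case: ifPn => // _; ring.
Qed.

Lemma convRn_permRn m (p : 'S_m) (s : R) (x y : Rn R m) :
  permRn p (convRn s x y) = convRn s (permRn p x) (permRn p y).
Proof. by apply: eq_from_tnth => j; rewrite !tnth_mktuple. Qed.

Lemma lebesgueRn_reflRn0 (F : Rn R n.+1 -> \bar R) :
  measurable_fun setT F -> (forall x, 0 <= F x) ->
  \int[lebesgueRn R n.+1]_x F (reflRn ord0 x) = \int[lebesgueRn R n.+1]_x F x.
Proof.
move=> mF F0.
have mFg : measurable_fun setT (F \o @reflRn R n.+1 ord0).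
  exact: (measurableT_comp mF (measurable_reflRn _)).
rewrite (ge0_integral_lebesgueRnS mF F0).
rewrite (ge0_integral_lebesgueRnS mFg (fun=> F0 _)); apply: eq_integral => t _.
under eq_integral do rewrite /= reflRn0.
rewrite (ge0_integral_lebesgueN (F := fun a => F (Rn_cons a t)))//.
by apply: measurableT_comp => //; exact: measurable_Rn_cons.
Qed.

Lemma lebesgueRn_swap (F : Rn R n.+2 -> \bar R) :
  measurable_fun setT F -> (forall x, 0 <= F x) ->
  \int[lebesgueRn R n.+2]_x F (permRn (tperm ord0 (lift ord0 ord0)) x) =
  \int[lebesgueRn R n.+2]_x F x.
Proof.
move=> mF F0.
have mFg : measurable_fun setT (F \o @permRn R n.+2 (tperm ord0 (lift ord0 ord0))).
  exact: (measurableT_comp mF (measurable_permRn _)).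
rewrite (ge0_integral_lebesgueRnSSC mF F0).
rewrite (ge0_integral_lebesgueRnSS mFg (fun=> F0 _)); apply: eq_integral => t _.
by apply: eq_integral => b _; apply: eq_integral => a _; rewrite /= permRn_swap.
Qed.

End crossing.

(** * From lines to R^n *)

Section planar.
Local Open Scope ereal_scope.
Variables (R : realType) (n : nat).
Local Notation leb := (@lebesgue_measure R).
Local Notation mR := (measurableTypeR R).
Local Notation i1 := (lift ord0 ord0 : 'I_n.+2).
Variables (nu : {measure set (Rn R n.+2) -> \bar R}) (rho : Rn R n.+2 -> R).
Hypothesis mrho : measurable_fun setT rho.
Hypothesis rho0 : forall x, (0 <= rho x)%R.
Hypothesis nuE : forall A, measurable A ->
  nu A = \int[lebesgueRn R n.+2]_(x in A) (rho x)%:E.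
Hypothesis rho_qc : forall s x y, (0 <= s <= 1 ->
  Num.min (rho x) (rho y) <= rho (convRn s x y))%R.
Hypothesis nu_refl : forall A, measurable A -> nu (reflRn ord0 @^-1` A) = nu A.
Hypothesis nu_swap : forall A, measurable A ->
  nu (permRn (tperm ord0 i1) @^-1` A) = nu A.

Variable (G : R -> R -> R).
Hypothesis mG : measurable_fun setT (fun p : mR * mR => G p.1 p.2).

Let G_ (x : Rn R n.+2) := G (tnth x ord0) (tnth x i1).

Let mG_ : measurable_fun setT G_.
Proof.
apply: (measurableT_comp (f := fun p : mR * mR => G p.1 p.2) mG
  (g := fun x : Rn R n.+2 => (tnth x ord0, tnth x i1))).
by apply: measurable_fun_pair; exact: measurable_tnth.
Qed.

Let pos (f : Rn R n.+2 -> R) x := Num.max (f x) 0%R.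

Let mpos (f : Rn R n.+2 -> R) : measurable_fun setT f -> measurable_fun setT (pos f).
Proof. by move=> mf; exact: measurable_maxr. Qed.

Let pos0 f x : (0 <= pos f x)%R. Proof. by rewrite le_max lexx orbT. Qed.

Let mGN : measurable_fun setT (fun x => - G_ x)%R.
Proof. exact: measurableT_comp. Qed.

Lemma min_quasiconcave (g : Rn R n.+2 -> Rn R n.+2) s x y :
  (g (convRn s x y) = convRn s (g x) (g y)) -> (0 <= s <= 1)%R ->
  (Num.min (Num.min (rho x) (rho (g x))) (Num.min (rho y) (rho (g y))) <=
   Num.min (rho (convRn s x y)) (rho (g (convRn s x y))))%R.
Proof.
move=> gE s01; have h1 := rho_qc x y s01; have h2 := rho_qc (g x) (g y) s01.
rewrite -gE in h2; move: h1 h2; rewrite !ge_min !le_min.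
by lra.
Qed.

(** The fibres are the lines in the direction of the first coordinate.  The
    density symmetrized by the reflection of that coordinate is even and
    quasiconcave on each of them, hence nonincreasing in the absolute value. *)
Lemma axis_domination : (forall b, crossing (G ^~ b)) ->
  \int[nu]_x (Num.max (- G (tnth x ord0) (tnth x i1)) 0)%:E <=
  \int[nu]_x (Num.max (G (tnth x ord0) (tnth x i1)) 0)%:E.
Proof.
move=> cG; pose rh x := Num.min (rho x) (rho (reflRn ord0 x)).
have mrh : measurable_fun setT rh.
  by apply: measurable_minr => //; exact: (measurableT_comp mrho (measurable_reflRn _)).
have rh0 x : (0 <= rh x)%R by rewrite le_min !rho0.
have nurh A : measurable A -> nu A = \int[lebesgueRn R n.+2]_(x in A) (rh x)%:E.
  apply: density_min_involution => //; first exact: measurable_reflRn.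
    exact: reflRnK.
  exact: lebesgueRn_reflRn0.
have dens (f : Rn R n.+2 -> R) : measurable_fun setT f ->
    \int[nu]_x (pos f x)%:E =
    \int[lebesgueRn R n.+1]_t \int[leb]_a (pos f (Rn_cons a t) * rh (Rn_cons a t))%:E.
  move=> mf; have mp := mpos mf.
  rewrite (ge0_integral_density mrh rh0 nurh); last 2 first.
  - exact/measurable_EFinP.
  - by move=> x; rewrite lee_fin.
  rewrite (ge0_integral_lebesgueRnS (F := fun x => (pos f x)%:E * (rh x)%:E))//.
  - by apply: emeasurable_funM; exact/measurable_EFinP.
  - by move=> x; rewrite -EFinM lee_fin mulr_ge0.
rewrite [leLHS](dens _ mGN) [leRHS](dens _ mG_).
have mfib (f : Rn R n.+2 -> R) : measurable_fun setT f ->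
    measurable_fun setT (fun t : Rn R n.+1 =>
      \int[leb]_a (pos f (Rn_cons a t) * rh (Rn_cons a t))%:E).
  move=> mf; apply: (@measurable_fun_fubini_tonelli_G _ _ mR _ _ leb
    (fun p => (pos f (consRn p) * rh (consRn p))%:E)) => //.
  - apply/measurable_EFinP; apply: measurable_funM.
      exact: (measurableT_comp (mpos mf) (@measurable_consRn R n.+1)).
    exact: (measurableT_comp mrh (@measurable_consRn R n.+1)).
  - by move=> p; rewrite lee_fin mulr_ge0.
apply: ge0_le_integral; first exact: measurableT.
- by move=> t _; apply: integral_ge0 => a _; rewrite lee_fin mulr_ge0.
- exact: mfib.
- exact: mfib.
move=> t _.
have [s [c [s0 gneg gpos gint]]] := cG (tnth t ord0).
have GE a : G_ (Rn_cons a t) = G a (tnth t ord0).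
  by rewrite /G_ tnth_Rn_cons0 tnth_Rn_consS.
under eq_integral do rewrite /pos GE.
under [leRHS]eq_integral do rewrite /pos GE.
apply: (single_crossing (g := G ^~ (tnth t ord0)) (r := fun a => rh (Rn_cons a t))
  (s := s) (c := c)) => //.
- apply: (measurableT_comp (f := fun p : mR * mR => G p.1 p.2) mG
    (g := fun a => (a, tnth t ord0))).
  by apply: measurable_fun_pair; [exact: measurable_id|exact: measurable_cst].
- apply: (measurableT_comp mrh); apply: measurable_Rn_cons.
    exact: measurable_id.
  exact: measurable_cst.
- apply: even_quasiconcave_nonincreasing => [a|u a b u01].
    by rewrite /rh !reflRn0 opprK minC.
  have -> : Rn_cons (u * a + (1 - u) * b)%R t = convRn u (Rn_cons a t) (Rn_cons b t).
    by rewrite conv_Rn_cons convRnxx.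
  by apply: min_quasiconcave => //; exact: convRn_reflRn.
Qed.

(** On the line [x_0 + x_1 = z] the exchange of the two coordinates is the
    reflection [d |-> - d] for the parameter [d = x_0 - z / 2], so the density
    symmetrized by the exchange is even and quasiconcave in [d]. *)
Lemma antidiagonal_domination :
  (forall z, crossing (fun d => G (d + z / 2) (z / 2 - d))%R) ->
  \int[nu]_x (Num.max (- G (tnth x ord0) (tnth x i1)) 0)%:E <=
  \int[nu]_x (Num.max (G (tnth x ord0) (tnth x i1)) 0)%:E.
Proof.
move=> cG; pose g := @permRn R n.+2 (tperm ord0 i1).
pose rh x := Num.min (rho x) (rho (g x)).
have mrh : measurable_fun setT rh.
  by apply: measurable_minr => //; exact: (measurableT_comp mrho (measurable_permRn _)).
have rh0 x : (0 <= rh x)%R by rewrite le_min !rho0.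
have nurh A : measurable A -> nu A = \int[lebesgueRn R n.+2]_(x in A) (rh x)%:E.
  apply: density_min_involution => //; first exact: measurable_permRn.
    exact: permRnK.
  exact: lebesgueRn_swap.
pose line (z d : mR) t : Rn R n.+2 := Rn_cons (d + z / 2)%R (Rn_cons (z / 2 - d)%R t).
have mline t : measurable_fun setT (fun p : mR * mR => line p.1 p.2 t).
  apply: measurable_Rn_cons.
    by apply: measurable_funD => //; apply: measurable_funM.
  apply: measurable_Rn_cons; last exact: measurable_cst.
  by apply: measurable_funB => //; apply: measurable_funM.
have dens (f : Rn R n.+2 -> R) : measurable_fun setT f ->
    \int[nu]_x (pos f x)%:E =
    \int[lebesgueRn R n]_t \int[leb]_z \int[leb]_d
      (pos f (line z d t) * rh (line z d t))%:E.
  move=> mf; have mp := mpos mf.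
  rewrite (ge0_integral_density mrh rh0 nurh); last 2 first.
  - exact/measurable_EFinP.
  - by move=> x; rewrite lee_fin.
  pose F x := (pos f x * rh x)%:E.
  have mF : measurable_fun setT F by apply/measurable_EFinP/measurable_funM.
  have F0 x : 0 <= F x by rewrite lee_fin mulr_ge0.
  transitivity (\int[lebesgueRn R n.+2]_x F x).
    by apply: eq_integral => x _; rewrite /F EFinM.
  rewrite (ge0_integral_lebesgueRnSSC mF F0); apply: eq_integral => t _.
  (* The map (d, z) |-> (d + z/2, z/2 - d) is a composition of translations of one
     variable by a function of the other one, so it preserves the measure. *)
  transitivity (\int[leb]_a \int[leb]_z F (Rn_cons a (Rn_cons (z - a)%R t))).
    apply: eq_integral => a _.
    rewrite (ge0_integral_lebesgueD (F := fun b => F (Rn_cons a (Rn_cons b t))))//.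
    apply: (measurableT_comp mF); apply: measurable_Rn_cons.
      exact: measurable_cst.
    by apply: measurable_Rn_cons; [exact: measurable_id|exact: measurable_cst].
  pose H (p : mR * mR) := F (Rn_cons p.1 (Rn_cons (p.2 - p.1)%R t)).
  have mH : measurable_fun setT H.
    apply: (measurableT_comp mF); apply: measurable_Rn_cons; first exact: measurable_fst.
    by apply: measurable_Rn_cons; [exact: measurable_funB|exact: measurable_cst].
  rewrite -[LHS]/(\int[leb]_a \int[leb]_z H (a, z)).
  rewrite (fubini_tonelli (m1 := leb) (m2 := leb) H mH (fun=> F0 _)).
  apply: eq_integral => z _.
  have mHz : measurable_fun setT (fun a => H (a, z)).
    apply: (measurableT_comp mH).
    by apply: measurable_fun_pair; [exact: measurable_id|exact: measurable_cst].
  rewrite -(ge0_integral_lebesgueD (F := fun a => H (a, z)) (z / 2) mHz (fun=> F0 _)).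
  apply: eq_integral => d _; rewrite /H /F /line /=.
  by have -> : (z - (d + z / 2) = z / 2 - d)%R by field.
rewrite [leLHS](dens _ mGN) [leRHS](dens _ mG_).
have mfib2 (f : Rn R n.+2 -> R) : measurable_fun setT f ->
    forall t, measurable_fun setT (fun z : mR =>
      \int[leb]_d (pos f (line z d t) * rh (line z d t))%:E).
  move=> mf t; apply: (@measurable_fun_fubini_tonelli_F _ _ mR mR _ leb
    (fun p => (pos f (line p.1 p.2 t) * rh (line p.1 p.2 t))%:E)) => //.
  - apply/measurable_EFinP; apply: measurable_funM.
      exact: (measurableT_comp (mpos mf) (mline t)).
    exact: (measurableT_comp mrh (mline t)).
  - by move=> p; rewrite lee_fin mulr_ge0.
(* Measurability in t of the double integral: two successive partial
   integrations of a function of (t, z, d). *)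
have mfib1 (f : Rn R n.+2 -> R) : measurable_fun setT f ->
    measurable_fun setT (fun t : Rn R n =>
      \int[leb]_z \int[leb]_d (pos f (line z d t) * rh (line z d t))%:E).
  move=> mf; pose K (p : (Rn R n * mR) * mR) :=
    (pos f (line p.1.2 p.2 p.1.1) * rh (line p.1.2 p.2 p.1.1))%:E.
  have mL : measurable_fun setT
      (fun p : (Rn R n * mR) * mR => line p.1.2 p.2 p.1.1).
    have m1 : measurable_fun setT (fun p : (Rn R n * mR) * mR => p.1.2).
      exact: (measurableT_comp measurable_snd measurable_fst).
    have m2 : measurable_fun setT (fun p : (Rn R n * mR) * mR => p.1.1).
      exact: (measurableT_comp measurable_fst measurable_fst).
    apply: measurable_Rn_cons.
      by apply: measurable_funD => //; apply: measurable_funM.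
    apply: measurable_Rn_cons; last exact: m2.
    by apply: measurable_funB => //; apply: measurable_funM.
  have K0 p : 0 <= K p by rewrite lee_fin mulr_ge0.
  have mK : measurable_fun setT K.
    apply/measurable_EFinP; apply: measurable_funM.
      exact: (measurableT_comp (mpos mf) mL).
    exact: (measurableT_comp mrh mL).
  have mK1 := measurable_fun_fubini_tonelli_F (m2 := leb) K mK K0.
  apply: (measurable_fun_fubini_tonelli_F (m2 := leb) _ mK1) => p.
  exact: integral_ge0.
apply: ge0_le_integral; first exact: measurableT.
- move=> t _; apply: integral_ge0 => z _; apply: integral_ge0 => d _.
  by rewrite lee_fin mulr_ge0.
- exact: mfib1.
- exact: mfib1.
move=> t _; apply: ge0_le_integral; first exact: measurableT.
- by move=> z _; apply: integral_ge0 => d _; rewrite lee_fin mulr_ge0.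
- exact: mfib2.
- exact: mfib2.
move=> z _.
have [s [c [s0 gneg gpos gint]]] := cG z.
have GE d : G_ (line z d t) = G (d + z / 2)%R (z / 2 - d)%R.
  by rewrite /G_ /line tnth_Rn_cons0 tnth_Rn_cons1.
under eq_integral do rewrite /pos GE.
under [leRHS]eq_integral do rewrite /pos GE.
apply: (single_crossing (g := fun d => G (d + z / 2)%R (z / 2 - d)%R)
  (r := fun d => rh (line z d t)) (s := s) (c := c)) => //.
- apply: (measurableT_comp (f := fun p : mR * mR => G p.1 p.2) mG
    (g := fun d : mR => ((d + z / 2)%R, (z / 2 - d)%R))).
  by apply: measurable_fun_pair; [exact: measurable_funD|exact: measurable_funB].
- apply: (measurableT_comp mrh); apply: measurable_Rn_cons.
    exact: measurable_funD.
  by apply: measurable_Rn_cons; [exact: measurable_funB|exact: measurable_cst].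
- apply: even_quasiconcave_nonincreasing => [d|u a b u01].
    have -> : line z (- d)%R t = g (line z d t).
      by rewrite /g /line permRn_swap opprK addrC (addrC d).
    by rewrite /rh {2}/g permRnK minC.
  have -> : line z (u * a + (1 - u) * b)%R t = convRn u (line z a t) (line z b t).
    by rewrite /line !conv_Rn_cons convRnxx; congr (Rn_cons _ (Rn_cons _ _)); ring.
  by apply: min_quasiconcave => //; exact: convRn_permRn.
Qed.

End planar.

(** * The functions that change sign along lines *)

Section crossing_instances.
Local Open Scope ereal_scope.
Variable R : realType.
Local Notation leb := (@lebesgue_measure R).
Local Notation mR := (measurableTypeR R).
Implicit Types a b c x y z : R.

Lemma norm_le_sqrt x c : (x ^+ 2 <= c)%R -> (`|x| <= Num.sqrt c)%R.
Proof. by move=> xc; rewrite -sqrtr_sqr ler_wsqrtr. Qed.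

Lemma sqrt_le_norm x c : (c <= x ^+ 2)%R -> (Num.sqrt c <= `|x|)%R.
Proof. by move=> xc; rewrite -[leRHS]sqrtr_sqr ler_wsqrtr. Qed.

Lemma norm_lt_sqr x y : (`|x| < `|y|)%R = (x ^+ 2 < y ^+ 2)%R.
Proof. by rewrite -(real_normK (num_real x)) -(real_normK (num_real y)) ltr_pXn2r// nnegrE. Qed.

Lemma norm_le_sqr x y : (`|x| <= `|y|)%R = (x ^+ 2 <= y ^+ 2)%R.
Proof. by rewrite leNgt norm_lt_sqr -leNgt. Qed.

Definition quartic a0 a1 a2 x : R := (a0 + a1 * x ^+ 2 + a2 * x ^+ 4)%R.

Lemma measurable_quartic a0 a1 a2 (D : set mR) :
  measurable_fun D (quartic a0 a1 a2 : mR -> mR).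
Proof.
apply: measurable_funTS; rewrite /quartic.
apply: measurable_funD; first apply: measurable_funD.
- exact: measurable_cst.
- by apply: measurable_funM; [exact: measurable_cst|exact: exprn_measurable].
- by apply: measurable_funM; [exact: measurable_cst|exact: exprn_measurable].
Qed.

Lemma integrable_quartic a0 a1 a2 c :
  leb.-integrable `[(- c)%R, c] (EFin \o quartic a0 a1 a2).
Proof.
apply: continuous_compact_integrable; first exact: segment_compact.
apply: continuous_subspaceT => x.
rewrite (_ : quartic a0 a1 a2 = horner (a0%:P + a1 *: 'X^2 + a2 *: 'X^4)%R).
  exact: continuous_horner.
by apply/funext => y; rewrite /quartic !hornerE.
Qed.

Lemma quartic_neg_lty a0 a1 a2 c :
  \int[leb]_(x in `[(- c)%R, c]) (Num.max (- quartic a0 a1 a2 x) 0)%:E < +oo.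
Proof.
have mI : measurable (`[(- c)%R, c]%classic : set mR) by [].
have := integral_funeneg_lt_pinfty mI (integrable_quartic a0 a1 a2 c).
apply: le_lt_trans; rewrite le_eqVlt; apply/orP; left; apply/eqP.
by apply: eq_integral => x _; rewrite funenegE -EFinN EFin_max.
Qed.

Lemma quartic_neg_le_pos a0 a1 a2 c : (0 <= c)%R ->
  (0 <= a0 * c + a1 * c ^+ 3 / 3 + a2 * c ^+ 5 / 5)%R ->
  \int[leb]_(x in `[(- c)%R, c]) (Num.max (- quartic a0 a1 a2 x) 0)%:E <=
  \int[leb]_(x in `[(- c)%R, c]) (Num.max (quartic a0 a1 a2 x) 0)%:E.
Proof.
move=> c0 h; apply: integral_neg_le_pos => //.
- exact: measurable_quartic.
- exact: quartic_neg_lty.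
- by rewrite integral_even_quartic// lee_fin mulrn_wge0.
Qed.

Definition psi x y : R := (5 * (x ^+ 2 - y ^+ 2) ^+ 2 - 8 * (x ^+ 2 + y ^+ 2) + 8)%R.
(** The mean of [psi x] on [-x, x].  It is split as [psi_in x + psi_out x], where
    [x * psi_in x] is the primitive of [psi_out] that vanishes at [sqrt 3]: then
    the integral in [crossing_psi_max] vanishes, as it must for the uniform law on
    the extremal square. *)
Definition psi_mean x : R := (8 / 3 * (x ^+ 4 - 4 * x ^+ 2 + 3))%R.
Definition psi_out x : R := (4 / 9 * (x ^+ 2 - 3) * (5 * x ^+ 2 - 3))%R.
Definition psi_in x : R := (4 / 9 * (x ^+ 2 - 3) ^+ 2)%R.

(** [psi_min] carries the fluctuation of [psi] around its mean as the smaller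
    coordinate varies, and [psi_max] the mean as a function of the larger one.  In
    both, the first argument is the variable of integration.  The values on the
    diagonal are chosen so that [psi_split] holds everywhere. *)
Definition psi_min y x : R :=
  if (`|y| < `|x|)%R then (psi x y - psi_mean x)%R
  else if (`|x| < `|y|)%R then 0%R else (psi x x / 2 - psi_in x)%R.
Definition psi_max x y : R := if (`|x| <= `|y|)%R then psi_in y else psi_out x.

Let m1 : measurable_fun setT (fun p : mR * mR => p.1 : R) := measurable_fst.
Let m2 : measurable_fun setT (fun p : mR * mR => p.2 : R) := measurable_snd.

Let mpair (y : mR) : measurable_fun setT (fun x : mR => (x, y)).
Proof. by apply: measurable_fun_pair; [exact: measurable_id|exact: measurable_cst]. Qed.
Let n1 : measurable_fun setT (fun p : mR * mR => `|p.1 : R|%R).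
Proof. exact: (measurableT_comp (@normr_measurable R setT) m1). Qed.
Let n2 : measurable_fun setT (fun p : mR * mR => `|p.2 : R|%R).
Proof. exact: (measurableT_comp (@normr_measurable R setT) m2). Qed.

Ltac measurable_polynomial := repeat first
  [ exact: m1 | exact: m2 | exact: measurable_cst | apply: measurable_funX
  | apply: measurable_funB | apply: measurable_funD | apply: measurable_funM ].

Lemma measurable_psi_min :
  measurable_fun setT (fun p : mR * mR => psi_min p.1 p.2).
Proof.
apply: measurable_fun_ifT; last apply: measurable_fun_ifT.
- exact: measurable_fun_ltr.
- by rewrite /psi /psi_mean; measurable_polynomial.
- exact: measurable_fun_ltr.
- exact: measurable_cst.
- by rewrite /psi /psi_in; measurable_polynomial.
Qed.

Lemma measurable_psi_max :
  measurable_fun setT (fun p : mR * mR => psi_max p.1 p.2).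
Proof.
apply: measurable_fun_ifT.
- exact: measurable_fun_ler.
- by rewrite /psi_in; measurable_polynomial.
- by rewrite /psi_out; measurable_polynomial.
Qed.

Lemma psi_split x y :
  psi x y = (psi_min x y + psi_min y x + (psi_max x y + psi_max y x))%R.
Proof.
rewrite /psi_min /psi_max; case: (ltgtP `|x|%R `|y|%R) => [_|_|/eqP].
- by rewrite /psi /psi_mean /psi_in /psi_out; field.
- by rewrite /psi /psi_mean /psi_in /psi_out; field.
- rewrite eq_le !norm_le_sqr -eq_le => /eqP xy.
  by rewrite /psi /psi_in !xy; field.
Qed.

(** For [|y| < |x|] the function is [5 (Y - Y0) (Y - Y1)] with [Y = y ^+ 2] and
    [0 <= Y0 <= x ^+ 2 < Y1], so it changes sign only at [sqrt Y0], and its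
    integral over [-x, x] vanishes because [psi_mean x] is the mean. *)
Lemma crossing_psi_min x : crossing (psi_min ^~ x).
Proof.
set X := (x ^+ 2)%R; have X0 : (0 <= X)%R by exact: sqr_ge0.
pose D := Num.sqrt (40 / 3 * X ^+ 2 + 80 / 3 * X + 16)%R.
have D0 : (0 <= D)%R by exact: sqrtr_ge0.
have D2 : (D ^+ 2 = 40 / 3 * X ^+ 2 + 80 / 3 * X + 16)%R.
  by rewrite sqr_sqrtr//; nra.
pose Y0 := ((5 * X + 4 - D) / 5)%R; pose Y1 := ((5 * X + 4 + D) / 5)%R.
have minE y : (psi x y - psi_mean x = 5 * (y ^+ 2 - Y0) * (y ^+ 2 - Y1))%R.
  have -> : (5 * (y ^+ 2 - Y0) * (y ^+ 2 - Y1) =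
    5 * y ^+ 4 - 2 * (5 * X + 4) * y ^+ 2 + ((5 * X + 4) ^+ 2 - D ^+ 2) / 5)%R.
    by rewrite /Y0 /Y1; field.
  by rewrite D2 /psi /psi_mean /X; field.
have Y1X : (X < Y1)%R by rewrite /Y1; nra.
have diagE : (psi x x / 2 - psi_in x <= 0)%R by rewrite /psi /psi_in -/X; nra.
have Y0X : (Y0 <= X)%R.
  have : ((X - Y0) * (X - Y1) <= 0)%R.
    have := minE x; rewrite -/X -mulrA => e.
    rewrite -(@pmulr_rle0 _ 5%R)// -e /psi /psi_mean.
    by rewrite (_ : x ^+ 4 = X ^+ 2)%R ?/X; last (by ring); nra.
  by move=> h; rewrite leNgt; apply/negP => ?; nra.
have Y00 : (0 <= Y0)%R.
  rewrite /Y0; suff : (D <= 5 * X + 4)%R by lra.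
  by rewrite -(@ler_pXn2r _ 2)// ?nnegrE//; nra.
exists (Num.sqrt Y0), `|x|%R; split.
- exact: sqrtr_ge0.
- move=> y; rewrite /psi_min; case: (ltgtP `|y|%R `|x|%R) => [yx|_|yx _]; last 2 first.
  + by rewrite ltxx.
  + by rewrite andbT yx sqrt_le_norm.
  +
    rewrite minE => h; rewrite andbT; apply: sqrt_le_norm.
    move: yx; rewrite norm_lt_sqr -/X => yx.
    by rewrite leNgt; apply/negP => ?; nra.
- move=> y; rewrite /psi_min; case: (ltgtP `|y|%R `|x|%R) => [yx h _|_|yx]; last 2 first.
  + by rewrite ltxx.
  + by move=> /lt_geF; rewrite diagE.
  +
    apply: norm_le_sqrt.
    move: yx h; rewrite norm_lt_sqr minE -/X => yx h.
    by rewrite leNgt; apply/negP => ?; nra.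
- pose a0 := (7 / 3 * x ^+ 4 + 8 / 3 * x ^+ 2)%R.
  pose a1 := (- (10 * x ^+ 2 + 8))%R.
  have qle y : `[(- `|x|)%R, `|x|%R]%classic y -> (quartic a0 a1 5 y <= psi_min y x)%R.
    rewrite /= in_itv/= -ler_norml => yx.
    rewrite /psi_min; case: ltgtP yx => // [_ _|].
      by rewrite /quartic /a0 /a1 /psi /psi_mean; lra.
    move=> /(congr1 (fun z => z ^+ 2)%R); rewrite !real_normK ?num_real// => e _.
    rewrite /quartic /a0 /a1 (_ : y ^+ 4 = (y ^+ 2) ^+ 2)%R; last by ring.
    rewrite e /psi /psi_in (_ : x ^+ 4 = X ^+ 2)%R; last by rewrite /X; ring.
    by rewrite -/X; have := sqr_ge0 X; lra.
  have mm : measurable_fun setT (psi_min ^~ x : mR -> mR).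
    exact: (measurableT_comp measurable_psi_min (mpair x)).
  have mI : measurable (`[(- `|x|)%R, `|x|%R]%classic : set mR) by [].
  apply: (@le_trans _ _ (\int[leb]_(y in `[(- `|x|)%R, `|x|%R])
                         (Num.max (- quartic a0 a1 5 y) 0)%:E)).
    apply: ge0_le_integral => //.
    + by move=> y _; rewrite lee_fin le_max lexx orbT.
    + apply: measurable_funTS; apply/measurable_EFinP; apply: measurable_maxr => //.
      exact: measurableT_comp.
    + apply/measurable_EFinP; apply: measurable_maxr => //.
      by apply: measurableT_comp => //; exact: measurable_quartic.
    + move=> y /qle; rewrite lee_fin => h.
      by rewrite ge_max !le_max lexx orbT andbT lerN2 h.
  apply: (@le_trans _ _ (\int[leb]_(y in `[(- `|x|)%R, `|x|%R])
                         (Num.max (quartic a0 a1 5 y) 0)%:E)).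
    apply: quartic_neg_le_pos => //; rewrite le_eqVlt; apply/orP; left; apply/eqP.
    rewrite /a0 /a1 -(real_normK (num_real x)) (_ : x ^+ 4 = `|x| ^+ 4)%R.
      by field.
    by rewrite (_ : 4 = 2 * 2)%N// !exprM real_normK ?num_real.
  apply: ge0_le_integral => //.
  + by move=> y _; rewrite lee_fin le_max lexx orbT.
  + apply/measurable_EFinP; apply: measurable_maxr => //.
    exact: measurable_quartic.
  + by apply: measurable_funTS; apply/measurable_EFinP; apply: measurable_maxr.
  + move=> y /qle; rewrite lee_fin => h.
    by rewrite ge_max !le_max lexx orbT andbT h.
Qed.

(** As a function of [x] it is the nonnegative constant [psi_in y] up to [|y|], and
    then [psi_out x], which is negative exactly for [3 / 5 < x ^+ 2 < 3].  When
    [|y| <= sqrt 3], its integral over [- sqrt 3, sqrt 3] vanishes. *)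
Lemma crossing_psi_max y : crossing (psi_max ^~ y).
Proof.
have s30 : (0 <= Num.sqrt 3 :> R)%R by exact: sqrtr_ge0.
have s32 : (Num.sqrt 3 ^+ 2 = 3 :> R)%R by rewrite sqr_sqrtr.
have in0 : (0 <= psi_in y)%R by rewrite mulr_ge0 ?divr_ge0// sqr_ge0.
have xs (x : R) : (`|x| <= Num.sqrt 3)%R = (x ^+ 2 <= 3)%R.
  by rewrite -(ger0_norm s30) norm_le_sqr s32.
exists (Num.max `|y|%R (Num.sqrt (3 / 5))), (Num.sqrt 3); split.
- by rewrite le_max normr_ge0.
- move=> x; rewrite /psi_max; case: (leP `|x|%R `|y|%R) => [_|yx].
    by rewrite ltNge in0.
  rewrite /psi_out => h; rewrite ge_max (ltW yx) xs /= => //.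
  have h' : ((x ^+ 2 - 3) * (5 * x ^+ 2 - 3) < 0)%R by lra.
  apply/andP; split; last by nra.
  by apply: sqrt_le_norm; nra.
- move=> x; rewrite /psi_max le_max xs; case: (leP `|x|%R `|y|%R) => // yx.
  rewrite /psi_out => h x3 /=.
  have h' : (0 < (x ^+ 2 - 3) * (5 * x ^+ 2 - 3))%R by lra.
  by apply: norm_le_sqrt; nra.
have mm : measurable_fun setT (psi_max ^~ y : mR -> mR).
  exact: (measurableT_comp measurable_psi_max (mpair y)).
have mI : measurable (`[(- Num.sqrt 3)%R, Num.sqrt 3]%classic : set mR) by [].
have mJ : measurable (`[(- `|y|)%R, `|y|%R]%classic : set mR) by [].
have [y3|y3] := leP (y ^+ 2)%R 3%R; last first.
  rewrite (_ : integral _ _ _ = 0).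
    by apply: integral_ge0 => x _; rewrite lee_fin le_max lexx orbT.
  apply: integral0_eq => x _; rewrite max_r// oppr_le0 /psi_max.
  case: (leP `|x|%R `|y|%R) => // yx; rewrite norm_lt_sqr in yx.
  by rewrite /psi_out; nra.
pose qa := quartic 4 (- 8) (20 / 9).
pose qb := quartic (psi_in y - 4) 8 (- (20 / 9)).
have outE x : psi_out x = qa x by rewrite /psi_out /qa /quartic; field.
have E x : (psi_max x y)%:E = (qa x)%:E + ((EFin \o qb) \_ `[(- `|y|)%R, `|y|%R]) x.
  rewrite /psi_max patchE mem_setE in_itv/= -ler_norml.
  case: (leP `|x|%R `|y|%R) => _; last by rewrite adde0 outE.
  by rewrite -EFinD /qa /qb /quartic; congr EFin; lra.
have iqb : leb.-integrable `[(- Num.sqrt 3)%R, Num.sqrt 3]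
    ((EFin \o qb) \_ `[(- `|y|)%R, `|y|%R]).
  apply/integrable_restrict => //.
  apply: integrableS (integrable_quartic _ _ _ (Num.sqrt 3)) => //.
  exact: measurableI.
apply: integral_neg_le_pos => //.
- exact: measurable_funTS.
- apply: le_lt_trans (quartic_neg_lty 4 (- 8) (20 / 9) (Num.sqrt 3)).
  apply: ge0_le_integral => //.
  + by move=> x _; rewrite lee_fin le_max lexx orbT.
  + apply: measurable_funTS; apply/measurable_EFinP; apply: measurable_maxr => //.
    exact: measurableT_comp.
  + apply/measurable_EFinP; apply: measurable_maxr => //.
    by apply: measurableT_comp => //; exact: measurable_quartic.
  + move=> x _; rewrite lee_fin -/(qa x) -outE ge_max le_max [in X in _ && X]le_max.
    rewrite lexx orbT andbT /psi_max; case: (leP `|x|%R `|y|%R) => _.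
      by rewrite oppr_le0 in0 orbT.
    by rewrite lexx.
under eq_integral do rewrite E.
rewrite integralD//=; last exact: integrable_quartic.
rewrite -integral_mkcondr (_ : _ `&` _ = `[(- `|y|)%R, `|y|%R]%classic); last first.
  apply/setIidPr => x /=; rewrite !in_itv/= -!ler_norml xs => h.
  by rewrite norm_le_sqr in h; lra.
rewrite !integral_even_quartic// -EFinD lee_fin.
rewrite (_ : Num.sqrt 3 ^+ 3 = Num.sqrt 3 * 3)%R; last by rewrite exprS s32.
rewrite (_ : Num.sqrt 3 ^+ 5 = Num.sqrt 3 * (Num.sqrt 3 ^+ 2) ^+ 2)%R; last by ring.
rewrite s32.
rewrite le_eqVlt; apply/orP; left; apply/eqP.
rewrite (_ : `|y| ^+ 3 = `|y| * y ^+ 2)%R; last by rewrite exprS real_normK ?num_real.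
rewrite (_ : `|y| ^+ 5 = `|y| * (y ^+ 2) ^+ 2)%R; last first.
  by rewrite -(real_normK (num_real y)); ring.
by rewrite /psi_in; field.
Qed.

(** In terms of [d] this is [(8 d^2 - z^2) (4 d^2 - 2 z^2)].  The constant 34 is one
    for which both roots are simple and the integral up to the second root is
    positive. *)
Lemma crossing_antidiagonal z :
  crossing (fun d => 34 * ((d + z / 2) ^+ 2 * (z / 2 - d) ^+ 2)
    - (d + z / 2) ^+ 4 - (z / 2 - d) ^+ 4)%R.
Proof.
have E (d : R) : (34 * ((d + z / 2) ^+ 2 * (z / 2 - d) ^+ 2)
    - (d + z / 2) ^+ 4 - (z / 2 - d) ^+ 4 =
    quartic (2 * z ^+ 4) (- (20 * z ^+ 2)) 32 d)%R.
  by rewrite /quartic; field.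
rewrite (funext E).
have Q (d : R) : (quartic (2 * z ^+ 4) (- (20 * z ^+ 2)) 32 d =
    (8 * d ^+ 2 - z ^+ 2) * (4 * d ^+ 2 - 2 * z ^+ 2))%R.
  by rewrite /quartic; ring.
have z2 : (0 <= z ^+ 2)%R by exact: sqr_ge0.
exists (Num.sqrt (z ^+ 2 / 8)), (Num.sqrt (z ^+ 2 / 2)); split.
- exact: sqrtr_ge0.
- move=> d; rewrite Q => h.
  by rewrite sqrt_le_norm ?norm_le_sqrt//=; have := sqr_ge0 d; nra.
- move=> d; rewrite Q => h dc.
  have {}dc : (d ^+ 2 <= z ^+ 2 / 2)%R.
    rewrite -(@sqr_sqrtr _ (z ^+ 2 / 2)%R) ?divr_ge0//.
    by rewrite -(real_normK (num_real d)) ler_pXn2r ?nnegrE ?sqrtr_ge0.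
  by apply: norm_le_sqrt; rewrite leNgt; apply/negP => ?; nra.
- apply: quartic_neg_le_pos; first exact: sqrtr_ge0.
  set c := Num.sqrt _.
  have c0 : (0 <= c)%R by exact: sqrtr_ge0.
  have c2 : (c ^+ 2 = z ^+ 2 / 2)%R by rewrite sqr_sqrtr// divr_ge0.
  rewrite (_ : c ^+ 3 = c * c ^+ 2)%R; last by ring.
  rewrite (_ : c ^+ 5 = c * (c ^+ 2) ^+ 2)%R; last by ring.
  rewrite c2.
  have -> : (2 * z ^+ 4 * c + - (20 * z ^+ 2) * (c * (z ^+ 2 / 2)) / 3 +
    32 * (c * (z ^+ 2 / 2) ^+ 2) / 5 = 4 / 15 * c * (z ^+ 2) ^+ 2)%R by field.
  by rewrite mulr_ge0 ?sqr_ge0// mulr_ge0.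
Qed.

End crossing_instances.

(** * Quadratic forms *)

Section quadratic.
Variables (R : realType) (n : nat).

Definition quad (c : 'I_n * 'I_n -> R) (x : 'I_n -> R) : R :=
  \sum_p c p * (x p.1 * x p.2).

Let mm (p : 'I_n * 'I_n) : mpoly.multinom n :=
  mpoly.mnm_add (mpoly.mnm1 p.1) (mpoly.mnm1 p.2).

Let mmE p k : mm p k = ((p.1 == k) + (p.2 == k))%N.
Proof. by rewrite /mm mpoly.mnmDE !mpoly.mnm1E. Qed.

Let mdeg_mm p : mpoly.mdeg (mm p) = 2.
Proof. by rewrite /mm mpoly.mdegD !mpoly.mdeg1. Qed.

Let mm_inj : {in [pred p : 'I_n * 'I_n | (p.1 <= p.2)%N] &, injective mm}.
Proof.
move=> [i j] [k l]; rewrite !inE /= => ij kl /mpoly.mnmP h.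
have := h i; have := h j; have := h k; have := h l; rewrite !mmE /= !eqxx.
rewrite (eq_sym i j) (eq_sym i k) (eq_sym i l) (eq_sym j k) (eq_sym j l) (eq_sym k l).
case: (eqVneq j i) => [?|ji]; case: (eqVneq k i) => [?|ki];
  case: (eqVneq l i) => [?|li]; case: (eqVneq k j) => [?|kj];
  case: (eqVneq l j) => [?|lj]; case: (eqVneq l k) => [?|lk] //=; subst => //.
move=> _ _ _ _; congr (_, _); apply/val_inj/eqP; rewrite eqn_leq /=; apply/andP; split; lia.
Qed.

(** The monomials of degree 2 are the products [x_i * x_j] with [i <= j]. *)
Lemma sum_degree2 (V : nmodType) (F : mpoly.multinom n -> V) :
  \sum_(I : mpoly.bmultinom n 3 | mpoly.mdeg I == 2%N) F I =
  \sum_(p : 'I_n * 'I_n | (p.1 <= p.2)%N) F (mm p).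
Proof.
have lt3 p : (mpoly.mdeg (mm p) < 3)%N by rewrite mdeg_mm.
pose h p := mpoly.BMultinom (lt3 p).
transitivity (\sum_(I in [set h p | p in [pred p : 'I_n * 'I_n | (p.1 <= p.2)%N]]%SET) F I).
  apply: eq_bigl => I; apply/eqP/imsetP => [I2|[p _ ->]]; last exact: mdeg_mm.
  have [i Ii] : exists i, (0 < mpoly.bmnm I i)%N.
    apply/existsP; apply: contraT; rewrite negb_exists => /forallP h0.
    move: I2; rewrite mpoly.mdegE big1 // => k _.
    by apply/eqP; rewrite -leqn0 leqNgt; exact: h0.
  have := Ii; rewrite lt0n -mpoly.lep1mP => le1.
  have [j Ej] : exists j, mpoly.mnm_sub (mpoly.bmnm I) (mpoly.mnm1 i) = mpoly.mnm1 j.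
    have : mpoly.mdeg (mpoly.mnm_sub (mpoly.bmnm I) (mpoly.mnm1 i)) == 1%N.
      have := mpoly.mdegD (mpoly.mnm_sub (mpoly.bmnm I) (mpoly.mnm1 i)) (mpoly.mnm1 i).
      by rewrite mpoly.submK// I2 mpoly.mdeg1; lia.
    by rewrite mpoly.mdeg_eq1 => /existsP[j /eqP ->]; exists j.
  have IE : mpoly.bmnm I = mpoly.mnm_add (mpoly.mnm1 j) (mpoly.mnm1 i).
    by rewrite -Ej mpoly.submK.
  have [ij|/ltnW ji] := leqP i j.
    exists (i, j); first by rewrite inE.
    by apply/val_inj; rewrite /= IE /mm /= mpoly.addmC.
  exists (j, i); first by rewrite inE.
  by apply/val_inj; rewrite /= IE.
rewrite big_imset//= => p q pP qP /(congr1 (@mpoly.bmnm _ _)).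
exact: mm_inj.
Qed.

Lemma meval_quad (f : mpoly.mpoly n R) : homogeneous 2 f -> coeff 2 f = 1 ->
  exists c : 'I_n * 'I_n -> R,
    [/\ forall p : 'I_n * 'I_n, ~~ (p.1 <= p.2)%N -> c p = 0, \sum_p c p ^+ 2 = 1 &
        forall x, evalRn f x = quad c (tnth x)].
Proof.
move=> hf cf; exists (fun p : 'I_n * 'I_n => if (p.1 <= p.2)%N then mpoly.mcoeff (mm p) f else 0).
have cf2 : \sum_(I : mpoly.bmultinom n 3 | mpoly.mdeg I == 2%N)
    mpoly.mcoeff I f ^+ 2 = 1.
  move: cf; rewrite /coeff => /(congr1 (fun z => z ^+ 2)).
  by rewrite sqr_sqrtr ?expr1n//; apply: sumr_ge0 => I _; exact: sqr_ge0.
split.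
- by move=> p /negbTE ->.
- rewrite -cf2 (sum_degree2 (fun m => mpoly.mcoeff m f ^+ 2)) [RHS]big_mkcond; apply: eq_bigr => p _.
  by case: ifP => // _; rewrite expr0n.
move=> x; rewrite /evalRn mpoly.mevalE /quad.
pose F (m : mpoly.multinom n) := mpoly.mcoeff m f * \prod_i tnth x i ^+ (m i).
transitivity (\sum_(I : mpoly.bmultinom n 3 | mpoly.mdeg I == 2%N) F I).
  rewrite (ssrcomplements.big_mksub (mpoly.bmultinom n 3 : subFinType _) (F := F))//.
  - rewrite big_mkcond [RHS]big_mkcond; apply: eq_bigr => I _.
    have [If|If] := boolP (_ \in _); first by rewrite (mpoly.dhomog_mf hf If) eqxx.
    by rewrite /F mpoly.memN_msupp_eq0// mul0r if_same.
  - exact: mpoly.msupp_uniq.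
  - by move=> m mf; rewrite (mpoly.dhomog_mf hf mf).
rewrite (sum_degree2 F) big_mkcond; apply: eq_bigr => p _.
case: ifP => _; last by rewrite mul0r.
rewrite /F; congr (_ * _); under eq_bigr do rewrite mmE exprD.
have U j : \prod_i tnth x i ^+ (j == i) = tnth x j.
  rewrite (bigD1 j)//= eqxx expr1 big1 ?mulr1// => i /negbTE.
  by rewrite eq_sym => ->; rewrite expr0.
by rewrite big_split/= !U.
Qed.

End quadratic.

(** * Moments of a measure invariant under the hyperoctahedral group *)

Lemma integral_preserving d (T : measurableType d) (R : realType)
    (nu : {measure set T -> \bar R}) (h : T -> T) (f : T -> \bar R) :
  measurable_fun setT h -> (forall A, measurable A -> nu (h @^-1` A) = nu A) ->
  measurable_fun setT f -> (\int[nu]_x f (h x) = \int[nu]_x f x)%E.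
Proof.
move=> mh nuh mf.
have ge0 (F : T -> \bar R) : measurable_fun setT F -> (forall x, 0 <= F x)%E ->
    (\int[nu]_x F (h x) = \int[nu]_x F x)%E.
  move=> mF F0; transitivity (\int[pushforward nu h]_x F x)%E.
    by rewrite ge0_integral_pushforward//= preimage_setT.
  by apply: eq_measure_integral => //= A mA _; rewrite /pushforward nuh.
rewrite integralE [RHS]integralE; congr (_ - _)%E.
- rewrite -(ge0 _ (measurable_funepos mf) (fun=> funepos_ge0 _ _)).
  by apply: eq_integral => x _; rewrite !funeposE.
- rewrite -(ge0 _ (measurable_funeneg mf) (fun=> funeneg_ge0 _ _)).
  by apply: eq_integral => x _; rewrite !funenegE.
Qed.

Section moments.
Variables (R : realType) (n : nat).
Local Notation i1 := (lift ord0 ord0 : 'I_n.+2).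
Variable nu : {measure set (Rn R n.+2) -> \bar R}.
Implicit Types (g h : Rn R n.+2 -> R) (i j k l : 'I_n.+2).

(** An integrable majorant, up to a constant, of every polynomial of degree at most
    4 that occurs. *)
Definition env (x : Rn R n.+2) : R := 1 + \sum_i tnth x i ^+ 4.

Hypothesis ienv : nu.-integrable setT (EFin \o env).
Hypothesis nu_perm : forall s A, measurable A -> nu (permRn s @^-1` A) = nu A.
Hypothesis nu_refl : forall i A, measurable A -> nu (reflRn i @^-1` A) = nu A.

Definition tame g :=
  measurable_fun setT g /\ exists K, 0 <= K /\ forall x, `|g x| <= K * env x.

Local Notation L g := (\int[nu]_x g x).

Lemma env_ge1 x : 1 <= env x.
Proof. by rewrite lerDl sumr_ge0// => i _; rewrite exprn_even_ge0. Qed.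

Let env0 x : 0 <= env x := le_trans ler01 (env_ge1 x).

Lemma env_ge i x : 1 + tnth x i ^+ 4 <= env x.
Proof.
rewrite lerD2l (bigD1 i)//= lerDl sumr_ge0// => j _.
by rewrite exprn_even_ge0.
Qed.

Lemma env_ge2 i j x : i != j -> 1 + tnth x i ^+ 4 + tnth x j ^+ 4 <= env x.
Proof.
move=> ij; rewrite -addrA lerD2l (bigD1 i)//= lerD2l (bigD1 j) 1?eq_sym//= lerDl sumr_ge0// => k _.
by rewrite exprn_even_ge0.
Qed.

Lemma tame_integrable g : tame g -> nu.-integrable setT (EFin \o g).
Proof.
move=> [mg [K [K0 gK]]].
apply: (@le_integrable _ _ _ nu setT measurableT _ (fun x => (K%:E * (EFin \o env) x)%E)).
- exact/measurable_EFinP.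
- move=> x _; rewrite /comp/= lee_fin (le_trans (gK x))//.
  by rewrite ger0_norm// mulr_ge0.
- exact: integrableZl.
Qed.

Lemma eq_tame g h : g =1 h -> tame g -> tame h.
Proof. by move=> /funext ->. Qed.

Lemma tameD g h : tame g -> tame h -> tame (fun x => g x + h x).
Proof.
move=> [mg [K [K0 gK]]] [mh [K' [K0' hK]]]; split; first exact: measurable_funD.
exists (K + K'); split; first exact: addr_ge0.
by move=> x; rewrite (le_trans (ler_normD _ _))// mulrDl lerD.
Qed.

Lemma tameZ a g : tame g -> tame (fun x => a * g x).
Proof.
move=> [mg [K [K0 gK]]]; split.
  by apply: measurable_funM => //; exact: measurable_cst.
exists (`|a| * K); split; first exact: mulr_ge0.
by move=> x; rewrite normrM -mulrA ler_wpM2l.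
Qed.

Lemma tame_cst a : tame (fun=> a).
Proof.
split; first exact: measurable_cst.
by exists `|a|; split => // x; rewrite ler_peMr// env_ge1.
Qed.

Lemma tame_sum (I : Type) (r : seq I) (P : pred I) (G : I -> Rn R n.+2 -> R) :
  (forall a, P a -> tame (G a)) -> tame (fun x => \sum_(a <- r | P a) G a x).
Proof.
move=> tG; elim: r => [|a r IH].
  by apply: (eq_tame _ (tame_cst 0)) => x; rewrite big_nil.
apply: (@eq_tame (fun x => if P a
    then G a x + \sum_(b <- r | P b) G b x else \sum_(b <- r | P b) G b x)).
  by move=> x; rewrite big_cons.
by case: (boolP (P a)) => // Pa; apply: tameD => //; exact: tG.
Qed.

Lemma tame_mono4 i j k l :
  tame (fun x => tnth x i * tnth x j * (tnth x k * tnth x l)).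
Proof.
split.
  by apply: measurable_funM; apply: measurable_funM; exact: measurable_tnth.
exists 1; split => // x; rewrite mul1r !normrM.
(* a b c d <= (a^4 + b^4 + c^4 + d^4) / 4. *)
have amgm (a b c d : R) : 0 <= a -> 0 <= b -> 0 <= c -> 0 <= d ->
    a ^+ 4 + 1 <= env x -> b ^+ 4 + 1 <= env x -> c ^+ 4 + 1 <= env x -> d ^+ 4 + 1 <= env x ->
    a * b * (c * d) <= env x.
  move=> a0 b0 c0 d0 ha hb hc hd.
  have := sqr_ge0 (a * b - c * d); have := sqr_ge0 (a ^+ 2 - b ^+ 2).
  by have := sqr_ge0 (c ^+ 2 - d ^+ 2); nra.
have e m : `|tnth x m : R| ^+ 4 + 1 <= env x.
  by rewrite addrC -normrX ger0_norm ?exprn_even_ge0// env_ge.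
exact: amgm.
Qed.

Lemma tame_mono2 i j : tame (fun x => tnth x i * tnth x j).
Proof.
split; first by apply: measurable_funM; exact: measurable_tnth.
exists 1; split => // x; rewrite mul1r normrM.
have e m : `|tnth x m : R| ^+ 4 + 1 <= env x.
  by rewrite addrC -normrX ger0_norm ?exprn_even_ge0// env_ge.
have := e i; have := e j; set a := `|tnth x i : R|; set b := `|tnth x j : R|.
have := sqr_ge0 (a - b); have := sqr_ge0 (a ^+ 2 - 1); have := sqr_ge0 (b ^+ 2 - 1).
by nra.
Qed.

Lemma RintegralD_tame g h : tame g -> tame h -> L (fun x => g x + h x) = L g + L h.
Proof. by move=> tg th; rewrite RintegralD//; exact: tame_integrable. Qed.

Lemma RintegralZ_tame a g : tame g -> L (fun x => a * g x) = a * L g.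
Proof. by move=> tg; rewrite RintegralZl//; exact: tame_integrable. Qed.

Lemma Rintegral_sum (I : Type) (r : seq I) (P : pred I) (G : I -> Rn R n.+2 -> R) :
  (forall a, P a -> tame (G a)) ->
  L (fun x => \sum_(a <- r | P a) G a x) = \sum_(a <- r | P a) L (G a).
Proof.
move=> tG; elim: r => [|a r IH].
  rewrite big_nil; under eq_Rintegral do rewrite big_nil.
  by rewrite /Rintegral integral0.
rewrite big_cons; under eq_Rintegral do rewrite big_cons.
case: ifPn => // Pa; rewrite RintegralD_tame ?IH//; first exact: tG.
exact: tame_sum.
Qed.

Lemma Rintegral_perm s g : measurable_fun setT g -> L (g \o permRn s) = L g.
Proof.
move=> mg; rewrite /Rintegral; congr fine.
apply: (integral_preserving (f := EFin \o g) (@measurable_permRn _ _ s) (nu_perm s)).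
exact/measurable_EFinP.
Qed.

Lemma Rintegral_refl i g : measurable_fun setT g -> L (g \o reflRn i) = L g.
Proof.
move=> mg; rewrite /Rintegral; congr fine.
apply: (integral_preserving (f := EFin \o g) (@measurable_reflRn _ _ i) (nu_refl i)).
exact/measurable_EFinP.
Qed.

Definition mom0 := L (fun=> 1).
Definition mom2 := L (fun x => tnth x ord0 * tnth x ord0).
Definition mom4 := L (fun x => tnth x ord0 * tnth x ord0 * (tnth x ord0 * tnth x ord0)).
Definition mom22 := L (fun x => tnth x ord0 * tnth x ord0 * (tnth x i1 * tnth x i1)).

Lemma Rintegral_odd i g : tame g -> (forall x, g (reflRn i x) = - g x) -> L g = 0.
Proof.
move=> tg odd; have /eqP := Rintegral_refl i tg.1.
rewrite (_ : g \o _ = fun x => -1 * g x); last first.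
  by apply/funext => x /=; rewrite odd mulN1r.
rewrite RintegralZ_tame// mulN1r => /eqP h; lra.
Qed.

Lemma tnth_refl i j (x : Rn R n.+2) :
  tnth (reflRn i x) j = (-1) ^+ (j == i) * tnth x j :> R.
Proof.
by rewrite tnth_mktuple; case: (j == i); rewrite ?expr0 ?expr1 ?mul1r ?mulN1r.
Qed.

Lemma Rintegral_sqr i : L (fun x => tnth x i * tnth x i) = mom2.
Proof.
rewrite /mom2 -(Rintegral_perm (tperm ord0 i) (tame_mono2 ord0 ord0).1).
by apply: eq_Rintegral => x _ /=; rewrite !tnth_mktuple tpermL.
Qed.

Lemma Rintegral_fourth i : L (fun x => tnth x i * tnth x i * (tnth x i * tnth x i)) = mom4.
Proof.
rewrite /mom4 -(Rintegral_perm (tperm ord0 i) (tame_mono4 ord0 ord0 ord0 ord0).1).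
by apply: eq_Rintegral => x _ /=; rewrite !tnth_mktuple tpermL.
Qed.

Lemma Rintegral_sqr_sqr i j : i != j ->
  L (fun x => tnth x i * tnth x i * (tnth x j * tnth x j)) = mom22.
Proof.
(* A permutation that sends 0 to i and 1 to j. *)
move=> ij; pose s := (tperm i1 (tperm ord0 i j) * tperm ord0 i)%g.
have s0 : s ord0 = i.
  rewrite permM (@tpermD _ i1 _ ord0) ?tpermL//.
  by rewrite -[X in _ != X](tpermR ord0 i) (inj_eq perm_inj) eq_sym.
have s1 : s i1 = j by rewrite permM tpermL tpermK.
rewrite /mom22 -(Rintegral_perm s (tame_mono4 ord0 ord0 i1 i1).1).
by apply: eq_Rintegral => x _ /=; rewrite !tnth_mktuple s0 s1.
Qed.

Lemma Rintegral_mono2_offdiag i j : i != j -> L (fun x => tnth x i * tnth x j) = 0.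
Proof.
move=> ij; apply: (Rintegral_odd (i := i)); first exact: tame_mono2.
move=> x; rewrite !tnth_refl eqxx eq_sym (negbTE ij) expr0 expr1 mul1r.
by rewrite mulN1r mulNr.
Qed.

(** Under the reflection of the coordinate [m] the monomial changes sign. *)
Lemma Rintegral_mono4_odd m i j k l :
  odd ((i == m) + (j == m) + (k == m) + (l == m)) ->
  L (fun x => tnth x i * tnth x j * (tnth x k * tnth x l)) = 0.
Proof.
move=> o; apply: (Rintegral_odd (i := m)); first exact: tame_mono4.
move=> x; rewrite !tnth_refl.
have -> (a b c d p q r s : R) : a * p * (b * q) * (c * r * (d * s)) =
  (a * b * c * d) * (p * q * (r * s)) by ring.
by rewrite -!exprD -signr_odd o expr1 mulN1r.
Qed.

(** The ordering of the indices in [p] and [q] excludes [p = (i, j)], [q = (j, i)],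
    so two off-diagonal monomials are orthogonal unless they coincide; in all the
    other vanishing cases some index occurs an odd number of times. *)
Lemma Rintegral_mono4 (p q : 'I_n.+2 * 'I_n.+2) : (p.1 <= p.2)%N -> (q.1 <= q.2)%N ->
  L (fun x => tnth x p.1 * tnth x p.2 * (tnth x q.1 * tnth x q.2)) =
  (p.1 == p.2)%:R * (q.1 == q.2)%:R * mom22
    + (p == q)%:R * (if p.1 == p.2 then mom4 - mom22 else mom22).
Proof.
case: p q => [i j] [k l] /= ij kl; rewrite xpair_eqE.
case: (eqVneq i j) ij => [<-{j} _|ij le_ij].
  case: (eqVneq k l) kl => [<-{l} _|kl le_kl].
    rewrite !mul1r; case: (eqVneq i k) => [<-|ik].
      by rewrite Rintegral_fourth mul1r addrC subrK.
    by rewrite Rintegral_sqr_sqr// mul0r addr0.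
  rewrite (Rintegral_mono4_odd (m := k)).
    rewrite mulr0 mul0r add0r; case: (eqVneq i k) => [ik|]; last by rewrite mul0r.
    by rewrite ik (negbTE kl) mul0r.
  by rewrite eqxx (eq_sym l) (negbTE kl); case: (i == k).
rewrite mul0r mul0r add0r.
case: (eqVneq k l) kl => [<-{l} _|kl le_kl].
  rewrite (Rintegral_mono4_odd (m := i)).
    case: (eqVneq i k) => [ik|]; last by rewrite mul0r.
    by rewrite -ik (eq_sym j) (negbTE ij) mul0r.
  by rewrite eqxx (eq_sym j) (negbTE ij); case: (k == i).
have [/andP[/eqP <- /eqP <-]|ne] := boolP ((i == k) && (j == l)).
  rewrite mul1r -(Rintegral_sqr_sqr ij).
  by apply: eq_Rintegral => x _; ring.
rewrite mul0r.
have [ki|ki] := eqVneq k i; last have [li|li] := eqVneq l i.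
- rewrite (Rintegral_mono4_odd (m := j))// eqxx ki (negbTE ij).
  by move: ne; rewrite ki eqxx /= eq_sym => /negbTE ->.
- rewrite (Rintegral_mono4_odd (m := j))// eqxx li (negbTE ij).
  have -> : (k == j) = false.
    apply/negP => /eqP kj; move: le_kl; rewrite kj li => ji.
    by move: ij; rewrite -val_eqE eqn_leq le_ij ji.
  by [].
- by rewrite (Rintegral_mono4_odd (m := i))// eqxx (eq_sym j) (negbTE ij) (negbTE ki) (negbTE li).
Qed.

End moments.

(** * Moment inequalities *)

Section psi_bound.
Variable R : realType.
Implicit Types x y : R.

Let sqr4 x : x ^+ 4 = (x ^+ 2) ^+ 2. Proof. by rewrite -exprM. Qed.

Lemma psi_min_bound y x : `|psi_min y x| <= 20 * (1 + y ^+ 4 + x ^+ 4).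
Proof.
have Y0 := sqr_ge0 y; have X0 := sqr_ge0 x.
rewrite /psi_min ler_norml !norm_lt_sqr /psi /psi_mean /psi_in !sqr4.
set Y := y ^+ 2 in Y0 *; set X := x ^+ 2 in X0 *.
by case: ifPn => _; [|case: ifPn => _]; apply/andP; split; nra.
Qed.

Lemma psi_max_bound x y : `|psi_max x y| <= 20 * (1 + x ^+ 4 + y ^+ 4).
Proof.
have Y0 := sqr_ge0 y; have X0 := sqr_ge0 x.
rewrite /psi_max ler_norml /psi_out /psi_in !sqr4.
set Y := y ^+ 2 in Y0 *; set X := x ^+ 2 in X0 *.
by case: ifPn => _; apply/andP; split; nra.
Qed.

End psi_bound.

Section moment_inequalities.
Variables (R : realType) (n : nat).
Local Notation i1 := (lift ord0 ord0 : 'I_n.+2).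
Local Notation mR := (measurableTypeR R).
Variables (nu : {measure set (Rn R n.+2) -> \bar R}) (rho : Rn R n.+2 -> R).
Hypothesis ienv : nu.-integrable setT (EFin \o @env R n).
Hypothesis nu_perm : forall s A, measurable A -> nu (permRn s @^-1` A) = nu A.
Hypothesis nu_refl : forall i A, measurable A -> nu (reflRn i @^-1` A) = nu A.
Hypothesis mrho : measurable_fun setT rho.
Hypothesis rho0 : forall x, 0 <= rho x.
Hypothesis nuE : forall A, measurable A ->
  (nu A = \int[lebesgueRn R n.+2]_(x in A) (rho x)%:E)%E.
Hypothesis rho_qc : forall s x y, 0 <= s <= 1 ->
  Num.min (rho x) (rho y) <= rho (convRn s x y).
Implicit Types c : 'I_n.+2 * 'I_n.+2 -> R.

Local Notation L g := (\int[nu]_x g x).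
Local Notation m0 := (mom0 nu).
Local Notation m2 := (mom2 nu).
Local Notation m4 := (mom4 nu).
Local Notation m22 := (mom22 nu).

Definition diag (p : 'I_n.+2 * 'I_n.+2) : R := (p.1 == p.2)%:R.
Definition diag_sum c := \sum_p c p * diag p.

Let tmono2 := @tame_mono2 R n.
Let tmono4 := @tame_mono4 R n.

Lemma tame_quad c : tame (fun x => quad c (tnth x)).
Proof. by apply: tame_sum => p _; apply: tameZ; exact: tmono2. Qed.

Let quad_sqrE c (x : Rn R n.+2) : quad c (tnth x) ^+ 2 =
  \sum_p \sum_q c p * c q *
    (tnth x p.1 * tnth x p.2 * (tnth x q.1 * tnth x q.2)).
Proof.
rewrite expr2 /quad mulr_suml; apply: eq_bigr => p _.
by rewrite mulr_sumr; apply: eq_bigr => q _; rewrite mulrACA.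
Qed.

Lemma tame_quad_sqr c : tame (fun x => quad c (tnth x) ^+ 2).
Proof.
apply: (eq_tame (fun x => esym (quad_sqrE c x))).
by apply: tame_sum => p _; apply: tame_sum => q _; apply: tameZ; exact: tmono4.
Qed.

Lemma Rintegral_quad c : L (fun x => quad c (tnth x)) = diag_sum c * m2.
Proof.
rewrite /quad (Rintegral_sum ienv); last by move=> p _; apply: tameZ; exact: tmono2.
rewrite /diag_sum mulr_suml; apply: eq_bigr => p _.
rewrite (RintegralZ_tame ienv _ (tmono2 _ _)).
rewrite -mulrA; congr (_ * _); rewrite /diag.
case: (eqVneq p.1 p.2) => [->|ne]; first by rewrite mul1r Rintegral_sqr.
by rewrite mul0r (Rintegral_mono2_offdiag ienv nu_refl).
Qed.

Lemma Rintegral_quad_sqr c : (forall p : 'I_n.+2 * 'I_n.+2, ~~ (p.1 <= p.2)%N -> c p = 0) ->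
  L (fun x => quad c (tnth x) ^+ 2) =
  m22 * diag_sum c ^+ 2 + (m4 - m22) * (\sum_p c p ^+ 2 * diag p)
    + m22 * (\sum_p c p ^+ 2 * (1 - diag p)).
Proof.
move=> cup; rewrite (funext (quad_sqrE c)).
rewrite (Rintegral_sum ienv); last first.
  by move=> p _; apply: tame_sum => q _; apply: tameZ; exact: tmono4.
transitivity (\sum_p \sum_q (m22 * ((c p * diag p) * (c q * diag q))
   + (p == q)%:R * (c p * c q * ((m4 - m22) * diag p + m22 * (1 - diag p))))).
  apply: eq_bigr => p _; rewrite (Rintegral_sum ienv); last by move=> q _; apply: tameZ; exact: tmono4.
  apply: eq_bigr => q _; rewrite (RintegralZ_tame ienv _ (tmono4 _ _ _ _)).
  have [hp|/cup ->] := boolP (p.1 <= p.2)%N; last by rewrite !(mul0r, mulr0) addr0.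
  have [hq|/cup ->] := boolP (q.1 <= q.2)%N; last by rewrite !(mul0r, mulr0) addr0.
  rewrite (Rintegral_mono4 ienv nu_perm nu_refl hp hq) /diag.
  by case: (p.1 == p.2) => /=; ring.
under eq_bigr do rewrite big_split/= -!mulr_sumr.
rewrite big_split/= -mulr_sumr -mulr_suml -expr2 -addrA; congr (_ + _).
rewrite !mulr_sumr -big_split/=; apply: eq_bigr => p _.
rewrite (bigD1 p)//= eqxx mul1r big1 ?addr0; last first.
  by move=> q /negbTE qp; rewrite eq_sym qp mul0r.
by ring.
Qed.

Lemma tame_quad_dev c s : tame (fun x => (quad c (tnth x) - s) ^+ 2).
Proof.
apply: (@eq_tame _ _ (fun x => quad c (tnth x) ^+ 2 + ((- (2 * s)) * quad c (tnth x) + s ^+ 2))).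
  by move=> x; ring.
apply: tameD; first exact: tame_quad_sqr.
by apply: tameD; [apply: tameZ; exact: tame_quad|exact: tame_cst].
Qed.

Lemma Rintegral_quad_dev c s : L (fun x => (quad c (tnth x) - s) ^+ 2) =
  L (fun x => quad c (tnth x) ^+ 2) - 2 * s * (diag_sum c * m2) + s ^+ 2 * m0.
Proof.
rewrite (_ : (fun x => _) = (fun x => quad c (tnth x) ^+ 2 +
    ((- (2 * s)) * quad c (tnth x) + s ^+ 2 * 1))); last first.
  by apply/funext => x; ring.
rewrite (RintegralD_tame ienv); last 2 first.
- exact: tame_quad_sqr.
- apply: tameD; first by apply: tameZ; exact: tame_quad.
  by apply: tameZ; exact: tame_cst.
rewrite (RintegralD_tame ienv); last 2 first.
- by apply: tameZ; exact: tame_quad.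
- by apply: tameZ; exact: tame_cst.
rewrite (RintegralZ_tame ienv _ (tame_quad _)) (RintegralZ_tame ienv _ (tame_cst n 1)) Rintegral_quad /mom0; ring.
Qed.

(** Turns a comparison of positive and negative parts into a sign. *)
Let Rintegral_dom_ge0 (g : Rn R n.+2 -> R) : tame g ->
  (\int[nu]_x (Num.max (- g x) 0)%:E <= \int[nu]_x (Num.max (g x) 0)%:E)%E ->
  0 <= L g.
Proof.
move=> tg dom; rewrite /Rintegral fine_ge0// integralE.
have ig := tame_integrable ienv tg.
rewrite sube_ge0.
  rewrite (_ : integral _ _ _ = \int[nu]_x (Num.max (- g x) 0)%:E)%E; last first.
    by apply: eq_integral => x _; rewrite funenegE -EFinN EFin_max.
  apply: (le_trans dom); rewrite le_eqVlt; apply/orP; left; apply/eqP.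
  by apply: eq_integral => x _; rewrite funeposE EFin_max.
by rewrite (integrable_neg_fin_num measurableT ig).
Qed.

Let tame2 (G : R -> R -> R) K :
  measurable_fun setT (fun p : mR * mR => G p.1 p.2) -> 0 <= K ->
  (forall x y, `|G x y| <= K * (1 + x ^+ 4 + y ^+ 4)) ->
  forall i j : 'I_n.+2, i != j -> tame (fun x : Rn R n.+2 => G (tnth x i) (tnth x j)).
Proof.
move=> mG K0 GK i j ij; split.
  apply: (measurableT_comp (f := fun p : mR * mR => G p.1 p.2) mG
    (g := fun x : Rn R n.+2 => (tnth x i, tnth x j))).
  by apply: measurable_fun_pair; exact: measurable_tnth.
exists K; split => // x; rewrite (le_trans (GK _ _))// ler_wpM2l//.
exact: env_ge2.
Qed.

Let nu_swap A : measurable A -> nu (permRn (tperm ord0 i1) @^-1` A) = nu A.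
Proof. exact: nu_perm. Qed.

Let Rintegral_swap (G : R -> R -> R) :
  measurable_fun setT (fun x : Rn R n.+2 => G (tnth x ord0) (tnth x i1)) ->
  L (fun x => G (tnth x i1) (tnth x ord0)) = L (fun x => G (tnth x ord0) (tnth x i1)).
Proof.
move=> mG; rewrite -(Rintegral_perm nu_perm (tperm ord0 i1) mG).
by apply: eq_Rintegral => x _ /=; rewrite !tnth_mktuple tpermL tpermR.
Qed.

(** The integral of [psi x_0 x_1] is nonnegative: by [psi_split] and the exchange of
    [x_0] and [x_1], it is twice the sum of the integrals of [psi_min x_0 x_1] and
    [psi_max x_0 x_1]. *)
Lemma mom4_sub_mom22_ge : 4 / 5 * (2 * m2 - m0) <= m4 - m22.
Proof.
pose A (x : Rn R n.+2) := psi_min (tnth x ord0) (tnth x i1).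
pose A' (x : Rn R n.+2) := psi_min (tnth x i1) (tnth x ord0).
pose B (x : Rn R n.+2) := psi_max (tnth x ord0) (tnth x i1).
pose B' (x : Rn R n.+2) := psi_max (tnth x i1) (tnth x ord0).
have tA : tame A by apply: (tame2 (@measurable_psi_min R) _ (@psi_min_bound R)).
have tA' : tame A' by apply: (tame2 (@measurable_psi_min R) _ (@psi_min_bound R)).
have tB : tame B by apply: (tame2 (@measurable_psi_max R) _ (@psi_max_bound R)).
have tB' : tame B' by apply: (tame2 (@measurable_psi_max R) _ (@psi_max_bound R)).
have LA : 0 <= L A.
  apply: Rintegral_dom_ge0 => //.
  apply: (axis_domination mrho rho0 nuE rho_qc (nu_refl ord0)
    (@measurable_psi_min R)) => x; exact: crossing_psi_min.
have LB : 0 <= L B.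
  apply: Rintegral_dom_ge0 => //.
  apply: (axis_domination mrho rho0 nuE rho_qc (nu_refl ord0)
    (@measurable_psi_max R)) => x; exact: crossing_psi_max.
have LA' : L A' = L A by exact: (Rintegral_swap tA.1).
have LB' : L B' = L B by exact: (Rintegral_swap tB.1).
pose xx i j k l (x : Rn R n.+2) : R := tnth x i * tnth x j * (tnth x k * tnth x l).
pose sq i (x : Rn R n.+2) : R := tnth x i * tnth x i.
have : L (fun x => A x + A' x + (B x + B' x)) =
  L (fun x => 5 * xx ord0 ord0 ord0 ord0 x + (5 * xx i1 i1 i1 i1 x
    + (-10 * xx ord0 ord0 i1 i1 x + (-8 * sq ord0 x + (-8 * sq i1 x + 8 * 1))))).
  apply: eq_Rintegral => x _; rewrite -psi_split /psi /xx /sq.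
  by ring.
have t4 i j k l : tame (xx i j k l) by exact: tmono4.
have t2 i : tame (sq i) by exact: tmono2.
have t0 : tame (fun x : Rn R n.+2 => 1) by exact: tame_cst.
rewrite !(RintegralD_tame ienv) ?(RintegralZ_tame ienv)//; do ?[assumption | exact: tameZ | apply: tameD].
rewrite LA' LB' (Rintegral_fourth nu_perm) (Rintegral_fourth nu_perm).
rewrite (Rintegral_sqr nu_perm) (Rintegral_sqr nu_perm) -/m22 -/m0.
lra.
Qed.

(** The integral of [34 x_0^2 x_1^2 - x_0^4 - x_1^4] is nonnegative, by the
    comparison along the lines [x_0 + x_1 = const]. *)
Lemma mom4_le : m4 <= 17 * m22.
Proof.
pose G (x y : R) := 34 * (x ^+ 2 * y ^+ 2) - x ^+ 4 - y ^+ 4.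
pose xx i j k l (x : Rn R n.+2) : R := tnth x i * tnth x j * (tnth x k * tnth x l).
have t4 i j k l : tame (xx i j k l) by exact: tmono4.
have mG : measurable_fun setT (fun p : mR * mR => G p.1 p.2).
  have m1 : measurable_fun setT (fun p : mR * mR => p.1 : R) by exact: measurable_fst.
  have m2' : measurable_fun setT (fun p : mR * mR => p.2 : R) by exact: measurable_snd.
  apply: measurable_funB; last exact: measurable_funX.
  apply: measurable_funB; last exact: measurable_funX.
  apply: measurable_funM; first exact: measurable_cst.
  by apply: measurable_funM; exact: measurable_funX.
have GE (x : Rn R n.+2) : 34 * xx ord0 ord0 i1 i1 x +
    (-1 * xx ord0 ord0 ord0 ord0 x + -1 * xx i1 i1 i1 i1 x) =
    G (tnth x ord0) (tnth x i1).
  by rewrite /G /xx; ring.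
have tG : tame (fun x : Rn R n.+2 => G (tnth x ord0) (tnth x i1)).
  by apply: (eq_tame GE); apply: tameD; [|apply: tameD]; exact: tameZ.
have : 0 <= L (fun x => G (tnth x ord0) (tnth x i1)).
  apply: Rintegral_dom_ge0 => //.
  by apply: (antidiagonal_domination mrho rho0 nuE rho_qc nu_swap mG) => z; exact: crossing_antidiagonal.
rewrite -(funext GE).
rewrite !(RintegralD_tame ienv) ?(RintegralZ_tame ienv)//; do ?[assumption | exact: tameZ | apply: tameD].
rewrite (Rintegral_fourth nu_perm) (Rintegral_fourth nu_perm) -/m22.
lra.
Qed.

Local Notation N := (n.+2%:R : R).

(** The coefficients of [|x|^2 / sqrt n]. *)
Definition normalized_diag (p : 'I_n.+2 * 'I_n.+2) : R := (Num.sqrt N)^-1 * diag p.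

Let sum_diag (F : 'I_n.+2 * 'I_n.+2 -> R) :
  \sum_p F p * diag p = \sum_i F (i, i).
Proof.
rewrite (eq_bigr (fun p => F (p.1, p.2) * diag (p.1, p.2))); last by case.
rewrite -(pair_bigA _ (fun i j => F (i, j) * diag (i, j)))/=; apply: eq_bigr => i _.
rewrite (bigD1 i)//= /diag eqxx mulr1 big1 ?addr0// => j ji.
by rewrite /= eq_sym (negbTE ji) mulr0.
Qed.

Let N0 : 0 < N. Proof. by rewrite ltr0n. Qed.

Let sqrtN0 : Num.sqrt N != 0. Proof. by rewrite sqrtr_eq0 -ltNge. Qed.

Let sqrtN2 : Num.sqrt N ^+ 2 = N. Proof. by rewrite sqr_sqrtr// ltW. Qed.

Lemma quad_normalized_diag (x : 'I_n.+2 -> R) :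
  quad normalized_diag x = (Num.sqrt N)^-1 * \sum_i x i ^+ 2.
Proof.
rewrite /quad mulr_sumr -(sum_diag (fun p => (Num.sqrt N)^-1 * (x p.1 * x p.2))).
by apply: eq_bigr => p _; rewrite /normalized_diag; ring.
Qed.

Lemma diag_sum_normalized : diag_sum normalized_diag = Num.sqrt N.
Proof.
rewrite /diag_sum sum_diag; under eq_bigr do rewrite /normalized_diag /diag eqxx mulr1.
rewrite sumr_const card_ord -[LHS]mulr_natr; apply: (mulfI sqrtN0).
by rewrite -expr2 sqrtN2 mulVKf.
Qed.

Lemma Rintegral_normalized_dev :
  L (fun x => (quad normalized_diag (tnth x) - Num.sqrt N) ^+ 2) =
  m4 - m22 + N * m22 - 2 * N * m2 + N * m0.
Proof.
rewrite Rintegral_quad_dev Rintegral_quad_sqr; last first.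
  by move=> p; rewrite /normalized_diag /diag -ltnNge => /gtn_eqF; rewrite -val_eqE => ->; rewrite mulr0.
rewrite diag_sum_normalized (sum_diag (fun p => normalized_diag p ^+ 2)).
rewrite (eq_bigr (fun=> N^-1)); last first.
  by move=> i _; rewrite /normalized_diag /diag eqxx mulr1 exprVn sqrtN2.
rewrite sumr_const card_ord -[N^-1 *+ _]mulr_natr mulVf ?lt0r_neq0//.
rewrite big1; last first.
  move=> p _; rewrite /normalized_diag /diag.
  by case: (_ == _); rewrite ?subrr ?mulr0// expr0n mul0r.
have -> : 2 * Num.sqrt N * (Num.sqrt N * m2) = 2 * Num.sqrt N ^+ 2 * m2 by ring.
by rewrite sqrtN2; ring.
Qed.

Let mom22_ge0 : 0 <= m22.
Proof.
by apply: Rintegral_ge0 => x _; rewrite -!expr2 mulr_ge0// sqr_ge0.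
Qed.

(** The integral of the square of [|x|^2 / sqrt n - sqrt n] is nonnegative; insert
    [mom4_le] into [Rintegral_normalized_dev]. *)
Lemma mom22_ge : N * (2 * m2 - m0) <= (N + 16) * m22.
Proof.
have : 0 <= L (fun x => (quad normalized_diag (tnth x) - Num.sqrt N) ^+ 2).
  by apply: Rintegral_ge0 => x _; exact: sqr_ge0.
by rewrite Rintegral_normalized_dev; have := mom4_le; lra.
Qed.

(** For a probability measure of unit second moments, [2 * m2 - m0] would be 1; the
    parameter [e] bounds the defect due to the truncation. *)
Section bounds.
Variables (c : 'I_n.+2 * 'I_n.+2 -> R) (e : R).
Hypothesis cup : forall p : 'I_n.+2 * 'I_n.+2, ~~ (p.1 <= p.2)%N -> c p = 0.
Hypothesis c1 : \sum_p c p ^+ 2 = 1.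
Hypothesis e0 : 0 <= e.
Hypothesis m20e : 1 - e <= 2 * m2 - m0.

Local Notation k := (4 / 5 - 16 / N - e).
Local Notation A := (\sum_p c p ^+ 2 * diag p).
Local Notation B := (\sum_p c p ^+ 2 * (1 - diag p)).

Let AB : A + B = 1.
Proof.
by rewrite -[RHS]c1 -big_split/=; apply: eq_bigr => p _; ring.
Qed.

Let A0 : 0 <= A.
Proof. by apply: sumr_ge0 => p _; rewrite mulr_ge0 ?sqr_ge0 ?ler0n. Qed.

Let B0 : 0 <= B.
Proof.
apply: sumr_ge0 => p _; rewrite mulr_ge0 ?sqr_ge0// subr_ge0 /diag.
by case: (_ == _).
Qed.

(** Cauchy-Schwarz inequality for the diagonal coefficients. *)
Let S2 : diag_sum c ^+ 2 <= N * A.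
Proof.
rewrite /diag_sum (sum_diag c) (sum_diag (fun p => c p ^+ 2)).
set s := \sum_i c (i, i).
have : 0 <= \sum_i (c (i, i) - s / N) ^+ 2 by apply: sumr_ge0 => i _; exact: sqr_ge0.
rewrite (eq_bigr (fun i => c (i, i) ^+ 2 + ((- (2 * (s / N))) * c (i, i) + (s / N) ^+ 2))); last first.
  by move=> i _; ring.
rewrite !big_split/= -mulr_sumr -/s sumr_const card_ord -[_ ^+ 2 *+ _]mulr_natr.
have -> : - (2 * (s / N)) * s + (s / N) ^+ 2 * N = - (s ^+ 2 / N).
  by field; rewrite lt0r_neq0.
by rewrite subr_ge0 ler_pdivrMr// mulrC.
Qed.

Let m42k : k <= m4 - m22.
Proof.
have h := mom4_sub_mom22_ge.
have : 0 <= 16 / N by rewrite divr_ge0// ltW.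
by move: (16 / N) h e0 m20e => q; lra.
Qed.

Let m22k : k <= m22.
Proof.
have h := mom22_ge; have p22 := mom22_ge0.
have q0 : 0 <= 16 / N by rewrite divr_ge0// ltW.
have [e1|e1] := leP 1 e.
  by move: (16 / N) q0 p22 => q; lra.
have m22' : N * (1 - e) <= (N + 16) * m22.
  by rewrite (le_trans _ h)// ler_pM2l.
have : (1 - 16 / N) * (1 - e) <= m22.
  rewrite -(@ler_pM2l _ (N + 16)) ?addr_gt0// (le_trans _ m22')//.
  have -> : (N + 16) * ((1 - 16 / N) * (1 - e)) = (N - 16 * (16 / N)) * (1 - e).
    by field; rewrite lt0r_neq0.
  by rewrite ler_pM2r ?subr_gt0// gerBl mulr_ge0.
have -> : (1 - 16 / N) * (1 - e) = 1 - 16 / N - e + 16 / N * e by ring.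
by have := mulr_ge0 q0 e0; move: (16 / N) => q; lra.
Qed.

Lemma Rintegral_quad_sqr_ge : 4 / 5 - 16 / N - e <= L (fun x => quad c (tnth x) ^+ 2).
Proof.
rewrite Rintegral_quad_sqr//.
have := mulr_ge0 mom22_ge0 (sqr_ge0 (diag_sum c)).
have := ler_wpM2r A0 m42k; have := ler_wpM2r B0 m22k.
have : k * A + k * B = k by rewrite -mulrDr AB mulr1.
by move: k => k0; lra.
Qed.

(** With [t = S^2 / n], the right-hand side is the convex combination of
    [m4 - m22], [V] and [m22] with weights [A - t], [t] and [B]. *)
Lemma Rintegral_quad_dev_ge :
  Num.min (L (fun x => (quad normalized_diag (tnth x) - Num.sqrt N) ^+ 2))
    (4 / 5 - 16 / N - e) <=
  L (fun x => (quad c (tnth x) - diag_sum c) ^+ 2).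
Proof.
set V := L _; set m := Num.min _ _.
have [mV mk] : m <= V /\ m <= k by rewrite !ge_min !lexx orbT.
pose t := diag_sum c ^+ 2 / N.
have t0 : 0 <= t by rewrite divr_ge0 ?sqr_ge0// ltW.
have tA : 0 <= A - t by rewrite subr_ge0 ler_pdivrMr// mulrC.
have SE : diag_sum c ^+ 2 = N * t by rewrite /t mulrC divfK// lt0r_neq0.
have -> : L (fun x => (quad c (tnth x) - diag_sum c) ^+ 2) =
    (m4 - m22) * (A - t) + V * t + m22 * B.
  rewrite Rintegral_quad_dev Rintegral_quad_sqr// /V Rintegral_normalized_dev.
  have -> : 2 * diag_sum c * (diag_sum c * m2) = 2 * diag_sum c ^+ 2 * m2 by ring.
  by rewrite SE; ring.
have := ler_wpM2r tA (le_trans mk m42k); have := ler_wpM2r t0 mV.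
have := ler_wpM2r B0 (le_trans mk m22k).
have : m * (A - t) + m * t + m * B = m by rewrite -!mulrDr subrK AB mulr1.
lra.
Qed.

End bounds.

End moment_inequalities.

(** * Truncation to boxes and passage to the limit *)

Lemma mine_limit_le (R : realType) (a b : (\bar R)^nat) (l m w : \bar R) :
  a @ \oo --> l -> b @ \oo --> m ->
  (forall k, (Order.min (a k) (b k) <= w)%E) -> (Order.min l m <= w)%E.
Proof.
move=> al bm h; rewrite leNgt; apply/negP; rewrite lt_min => /andP[wl wm].
have wa : \forall k \near \oo, (w < a k)%E := al _ (open_ereal_gt' wl).
have wb : \forall k \near \oo, (w < b k)%E := bm _ (open_ereal_gt' wm).
have [k _ kab] : \forall k \near \oo, (w < Order.min (a k) (b k))%E.
  by near=> k; rewrite lt_min; apply/andP; split; near: k.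
by have := kab k (leqnn k); rewrite ltNge h.
Unshelve. all: by end_near. Qed.

Section log_concave_density.
Variables (R : realType) (n : nat) (eta : probability (Rn R n) R).

(** Convexity of [phi] gives [phi (s x + (1 - s) y) <= max (phi x) (phi y)], and
    [t |-> exp (- t)] is decreasing.  The density is finite because [phi] avoids
    [-oo]. *)
Lemma log_concave_quasiconcave_density : log_concave eta ->
  exists rho : Rn R n -> R, [/\ measurable_fun setT rho, forall x, 0 <= rho x,
    forall A, measurable A -> (eta A = \int[lebesgueRn R n]_(x in A) (rho x)%:E)%E &
    forall s x y, 0 <= s <= 1 -> Num.min (rho x) (rho y) <= rho (convRn s x y)].
Proof.
move=> [phi [phiNy cphi mphi etaE]].
pose rho x := fine (expeR (- phi x)%E).
have rhoE x : ((rho x)%:E = expeR (- phi x))%E.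
  by rewrite /rho; case: (phi x) (phiNy x).
exists rho; split.
- apply/measurable_EFinP; rewrite (_ : _ \o _ = (fun x => expeR (- phi x)%E))//.
  by apply/funext => x; rewrite /= rhoE.
- by move=> x; rewrite -lee_fin rhoE expeR_ge0.
- by move=> A mA; rewrite etaE//; apply: eq_integral => x _; rewrite rhoE.
- move=> s x y s01; rewrite -lee_fin EFin_min !rhoE.
  wlog xy : s x y s01 / (phi x <= phi y)%E.
    move=> wl; have [xy|/ltW yx] := leP (phi x) (phi y); first exact: wl.
    rewrite (_ : convRn s x y = convRn (1 - s) y x); last first.
      by apply: eq_from_tnth => i; rewrite !tnth_mktuple; ring.
    by rewrite minC; apply: wl => //; move: s01; lra.
  rewrite ge_min; apply/orP; right; rewrite lee_expeR leeN2.
  apply: (le_trans (cphi x y s s01)).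
  move: s01 => /andP[s0 s1].
  apply: (@le_trans _ _ (s%:E * phi y + (1 - s)%:E * phi y)%E).
    by rewrite leeD2r// lee_wpmul2l// lee_fin.
  rewrite -ge0_muleDl ?lee_fin ?subr_ge0//.
  by rewrite -EFinD addrC subrK mul1e.
Qed.

End log_concave_density.

Section truncation.
Variables (R : realType) (n : nat) (eta : probability (Rn R n.+2) R).
Hypothesis Heta : Hn_invariant eta.
Hypothesis Leta : log_concave eta.
Hypothesis Ieta : isotropic eta.

Definition box (k : nat) : set (Rn R n.+2) :=
  [set x | forall i, `|tnth x i : R| <= k%:R].

Lemma measurable_box k : measurable (box k).
Proof.
rewrite (_ : box k = \bigcap_(i in [set: 'I_n.+2])
    ((fun x : Rn R n.+2 => `|tnth x i : R|) @^-1` `]-oo, k%:R])).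
  apply: fin_bigcap_measurable; first exact: finite_finset.
  move=> i _; rewrite -[X in measurable X]setTI.
  have mf : measurable_fun setT (fun x : Rn R n.+2 => `|tnth x i : R|).
    exact: (measurableT_comp (@normr_measurable R setT) (measurable_tnth i)).
  by apply: mf.
apply/seteqP; split => x /= h.
  by move=> i _ /=; rewrite in_itv/=; exact: h.
by move=> i; have := h i Logic.I; rewrite /= in_itv.
Qed.

Definition trunc k := mrestr eta (measurable_box k).

Lemma ge0_integral_trunc k (F : Rn R n.+2 -> \bar R) : measurable_fun setT F ->
  (forall x, 0 <= F x)%E ->
  (\int[trunc k]_x F x = \int[eta]_x (F x * (\1_(box k) x)%:E))%E.
Proof.
move=> mF F0.
apply: (ge0_integral_density (rho := \1_(box k))) => //.
- by apply: measurable_indic; exact: measurable_box.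
- move=> A mA; rewrite /trunc /mrestr integral_indic//.
    by rewrite setIC.
  exact: measurable_box.
Qed.

Lemma le_integral_trunc k (F : Rn R n.+2 -> \bar R) : measurable_fun setT F ->
  (forall x, 0 <= F x)%E -> (\int[trunc k]_x F x <= \int[eta]_x F x)%E.
Proof.
move=> mF F0; rewrite ge0_integral_trunc//; apply: ge0_le_integral => //.
- by move=> x _; rewrite mule_ge0// lee_fin.
- apply: emeasurable_funM => //; apply/measurable_EFinP.
  by apply: measurable_indic; exact: measurable_box.
- move=> x _; rewrite -[leRHS]mule1 lee_wpmul2l// lee_fin indicE.
  by case: (_ \in _).
Qed.

(** Monotone convergence, as the boxes increase to the whole space. *)
Lemma cvg_integral_trunc (F : Rn R n.+2 -> \bar R) : measurable_fun setT F ->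
  (forall x, 0 <= F x)%E ->
  (\int[trunc k]_x F x)%E @[k --> \oo] --> (\int[eta]_x F x)%E.
Proof.
move=> mF F0.
under eq_fun do rewrite ge0_integral_trunc//.
have -> : (\int[eta]_x F x = \int[eta]_x limn (fun k => F x * (\1_(box k) x)%:E))%E.
  apply: eq_integral => x _; apply/esym/cvg_lim => //.
  have [K hK] : exists K : nat, box K x.
    exists (Num.truncn (\sum_i `|tnth x i : R|)).+1 => i.
    apply: (@le_trans _ _ (\sum_i `|tnth x i : R|)).
      by rewrite (bigD1 i)//= lerDl sumr_ge0.
    by apply/ltW; rewrite truncnS_gt.
  apply: (@cvg_trans _ (cst (F x) @ \oo)); last exact: cvg_cst.
  apply: near_eq_cvg; near=> k; rewrite /cst indicE mem_set ?mule1//.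
  move=> i; apply: (le_trans (hK i)); rewrite ler_nat.
  by near: k; exists K.
apply: cvg_monotone_convergence => //.
- move=> k; apply: emeasurable_funM => //; apply/measurable_EFinP.
  by apply: measurable_indic; exact: measurable_box.
- by move=> k x _; rewrite mule_ge0// lee_fin.
- move=> x _ k l kl; rewrite lee_wpmul2l// lee_fin !indicE ler_nat.
  case: (boolP (x \in box k)) => // /set_mem hx; rewrite mem_set// => i.
  by apply: (le_trans (hx i)); rewrite ler_nat.
Unshelve. all: by end_near. Qed.

Lemma trunc_perm k s A : measurable A -> trunc k (permRn s @^-1` A) = trunc k A.
Proof.
move=> mA; rewrite /trunc /mrestr.
have -> : permRn s @^-1` A `&` box k = permRn s @^-1` (A `&` box k).
  rewrite preimage_setI; congr (_ `&` _); apply/seteqP; split => x h i.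
    by rewrite tnth_mktuple.
  by have := h (s^-1%g i); rewrite tnth_mktuple permKV.
by apply: Heta.1; apply: measurableI => //; exact: measurable_box.
Qed.

Lemma trunc_refl k i A : measurable A -> trunc k (reflRn i @^-1` A) = trunc k A.
Proof.
move=> mA; rewrite /trunc /mrestr.
have -> : reflRn i @^-1` A `&` box k = reflRn i @^-1` (A `&` box k).
  rewrite preimage_setI; congr (_ `&` _); apply/seteqP; split => x h j.
    by rewrite tnth_refl normrMsign; exact: h.
  by have := h j; rewrite tnth_refl normrMsign.
by apply: Heta.2; apply: measurableI => //; exact: measurable_box.
Qed.

Lemma measurable_env : measurable_fun setT (@env R n).
Proof.
apply: measurable_funD; first exact: measurable_cst.
apply: measurable_sum => i.
by apply: measurable_funX; exact: measurable_tnth.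
Qed.

Lemma trunc_env k : (trunc k).-integrable setT (EFin \o @env R n).
Proof.
have mE : measurable_fun setT (EFin \o @env R n).
  by apply/measurable_EFinP; exact: measurable_env.
apply/integrableP; split => //.
have e0 (x : Rn R n.+2) : 0 <= env x := le_trans ler01 (env_ge1 x).
rewrite ge0_integral_trunc//; last first.
  by exact: measurableT_comp.
pose M : R := 1 + n.+2%:R * k%:R ^+ 4.
apply: (@le_lt_trans _ _ (\int[eta]_x (cst M%:E x))%E); last first.
  rewrite integral_cst//; apply: lte_mul_pinfty => //.
    by rewrite lee_fin addr_ge0// mulr_ge0// exprn_ge0.
  exact: (le_lt_trans (probability_le1 eta measurableT) (ltry 1)).
apply: ge0_le_integral => //.
- apply: emeasurable_funM.
    by exact: measurableT_comp.
  by apply/measurable_EFinP/measurable_indic; exact: measurable_box.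
move=> x _; rewrite /= (ger0_norm (e0 x)) -EFinM lee_fin indicE.
have [/set_mem xk|_] := boolP (x \in box k); last first.
  by rewrite mulr0 addr_ge0// mulr_ge0// exprn_ge0.
rewrite mulr1 /env lerD2l.
apply: (@le_trans _ _ (\sum_(i < n.+2) k%:R ^+ 4)).
  apply: ler_sum => i _.
  have -> : tnth x i ^+ 4 = `|tnth x i : R| ^+ 4.
    by rewrite -normrX ger0_norm// exprn_even_ge0.
  by rewrite lerXn2r ?nnegrE//; exact: xk.
by rewrite sumr_const card_ord mulr_natl.
Qed.

(** The indicator of a box is quasiconcave, and the product of two nonnegative
    quasiconcave functions one of which is an indicator is quasiconcave. *)
Lemma trunc_density k : exists rho : Rn R n.+2 -> R,
  [/\ measurable_fun setT rho, forall x, 0 <= rho x,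
    forall A, measurable A ->
      (trunc k A = \int[lebesgueRn R n.+2]_(x in A) (rho x)%:E)%E &
    forall s x y, 0 <= s <= 1 -> Num.min (rho x) (rho y) <= rho (convRn s x y)].
Proof.
have [rho [mrho rho0 etaE rho_qc]] := log_concave_quasiconcave_density Leta.
have mB := measurable_box k.
exists (fun x => rho x * \1_(box k) x); split.
- by apply: measurable_funM => //; exact: measurable_indic.
- by move=> x; rewrite mulr_ge0.
- move=> A mA; rewrite /trunc /mrestr etaE; last exact: measurableI.
  rewrite integral_mkcondr; apply: eq_integral => x _.
  by rewrite epatch_indic -EFinM.
move=> s x y s01; rewrite !indicE.
have [/set_mem xB|_] := boolP (x \in box k); last first.
  by rewrite mulr0 ge_min mulr_ge0.
have [/set_mem yB|_] := boolP (y \in box k); last first.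
  by rewrite mulr0 ge_min [X in _ || X]mulr_ge0// orbT.
rewrite mem_set ?mulr1 ?rho_qc// => i.
rewrite tnth_mktuple (le_trans (ler_normD _ _))// !normrM.
move: s01 => /andP[s0 s1]; have s1' : 0 <= 1 - s by rewrite subr_ge0.
rewrite (ger0_norm s0) (ger0_norm s1').
have -> : k%:R = s * k%:R + (1 - s) * k%:R :> R by ring.
by apply: lerD; apply: ler_wpM2l.
Qed.

Lemma isotropic_moment2 i j :
  eta.-integrable setT (EFin \o (fun x : Rn R n.+2 => tnth x i * tnth x j : R)) /\
  (\int[eta]_x (tnth x i * tnth x j)%:E = ((i == j)%:R)%:E)%E.
Proof.
have E2 k l : (\int[eta]_x (tnth x k * tnth x l)%:E = ((k == l)%:R)%:E)%E.
  have := Ieta.2 k l; rewrite unlock !Ieta.1 /= unlock => <-.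
  apply: eq_integral => x _; congr EFin.
  by congr (_ * _); exact: (esym (subr0 (_ : R))).
have mm k l : measurable_fun setT (fun x : Rn R n.+2 => tnth x k * tnth x l : R).
  by apply: measurable_funM; exact: measurable_tnth.
have isq k : eta.-integrable setT (EFin \o (fun x : Rn R n.+2 => tnth x k * tnth x k : R)).
  apply/integrableP; split; first exact/measurable_EFinP.
  rewrite (_ : (\int[eta]_x _)%E = \int[eta]_x (tnth x k * tnth x k)%:E)%E.
    by rewrite E2 eqxx ltry.
  by apply: eq_integral => x _; rewrite /= ger0_norm// -expr2 sqr_ge0.
split => //.
apply: (@le_integrable _ _ _ eta setT measurableT _
  ((EFin \o (fun x : Rn R n.+2 => (tnth x i * tnth x i)%R : R)) \+
   (EFin \o (fun x : Rn R n.+2 => (tnth x j * tnth x j)%R : R)))%E).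
- exact/measurable_EFinP.
- move=> x _; rewrite /= lee_fin [leRHS]ger0_norm; last first.
    by rewrite addr_ge0// -expr2 sqr_ge0.
  rewrite ler_norml; move: (tnth x i : R) (tnth x j : R) => a b.
  have := sqr_ge0 (a - b); have := sqr_ge0 (a + b).
  have := sqr_ge0 a; have := sqr_ge0 b.
  by move=> ? ? ? ?; apply/andP; split; nra.
- exact: integrableD.
Qed.

Lemma expectation_quad c : (\int[eta]_x (quad c (tnth x))%:E = (diag_sum c)%:E)%E.
Proof.
have i2 p : eta.-integrable setT
    (EFin \o (fun x : Rn R n.+2 => c p * (tnth x p.1 * tnth x p.2) : R)).
  rewrite (_ : _ \o _ = fun x : Rn R n.+2 =>
    ((c p)%:E * (EFin \o (fun x : Rn R n.+2 => (tnth x p.1 * tnth x p.2)%R : R)) x)%E)//.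
  by apply: integrableZl => //; exact: (isotropic_moment2 _ _).1.
transitivity (\int[eta]_x (\sum_p (c p * (tnth x p.1 * tnth x p.2))%:E))%E.
  by apply: eq_integral => x _; rewrite sumEFin.
rewrite integral_sum// /diag_sum -sumEFin; apply: eq_bigr => p _.
under eq_integral do rewrite EFinM.
rewrite integralZl//; last exact: (isotropic_moment2 _ _).1.
by rewrite (isotropic_moment2 _ _).2.
Qed.

Lemma variance_quad c :
  variance eta (fun x : Rn R n.+2 => quad c (tnth x)) =
  (\int[eta]_x ((quad c (tnth x) - diag_sum c) ^+ 2)%:E)%E.
Proof.
rewrite /variance !unlock expectation_quad /=.
by apply: eq_integral => x _; rewrite expr2.
Qed.

Definition trunc_err k : R := `|1 - (2 * mom2 (trunc k) - mom0 (trunc k))|.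

Lemma trunc_err_cvg : trunc_err k @[k --> \oo] --> (0 : R).
Proof.
have cvgR (g : Rn R n.+2 -> R) (l : R) : measurable_fun setT g ->
    (forall x, 0 <= g x) -> (\int[eta]_x (g x)%:E = l%:E)%E ->
    \int[trunc k]_x g x @[k --> \oo] --> l.
  move=> mg g0 gl; apply: fine_cvg; rewrite -gl.
  by apply: cvg_integral_trunc => //; exact/measurable_EFinP.
have c0 : mom0 (trunc k) @[k --> \oo] --> (1 : R).
  apply: (cvgR (fun=> 1)) => //.
  by rewrite integral_cst// mul1e; exact: probability_setT.
have c2 : mom2 (trunc k) @[k --> \oo] --> (1 : R).
  apply: (cvgR (fun x : Rn R n.+2 => tnth x ord0 * tnth x ord0)).
  - by apply: measurable_funM; exact: measurable_tnth.
  - by move=> x; rewrite -expr2 sqr_ge0.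
  - by rewrite (isotropic_moment2 _ _).2 eqxx.
rewrite [X in _ --> X](_ : 0 = `|1 - (2 * 1 - 1)| :> R); last first.
  by rewrite (_ : 1 - (2 * 1 - 1) = 0 :> R) ?normr0//; ring.
apply: cvg_norm; apply: cvgB; first exact: cvg_cst.
by apply: cvgB => //; apply: cvgM => //; exact: cvg_cst.
Qed.

Lemma trunc_err_ge k : 0 <= trunc_err k /\
  1 - trunc_err k <= 2 * mom2 (trunc k) - mom0 (trunc k).
Proof.
split; first exact: normr_ge0.
by have := ler_norm (1 - (2 * mom2 (trunc k) - mom0 (trunc k))); rewrite -/(trunc_err k); lra.
Qed.

Lemma trunc_RintegralE k g : tame g -> (forall x, 0 <= g x) ->
  ((\int[trunc k]_x g x)%:E = \int[trunc k]_x (g x)%:E)%E.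
Proof.
move=> tg g0; rewrite /Rintegral fineK//.
exact: (integrable_fin_num measurableT (tame_integrable (trunc_env k) tg)).
Qed.

Section quadratic_bounds.
Variable c : 'I_n.+2 * 'I_n.+2 -> R.
Hypothesis cup : forall p : 'I_n.+2 * 'I_n.+2, ~~ (p.1 <= p.2)%N -> c p = 0.
Hypothesis c1 : \sum_p c p ^+ 2 = 1.
Local Notation N := (n.+2%:R : R).

Let bound_cvg : (4 / 5 - 16 / N - trunc_err k)%:E @[k --> \oo] --> (4 / 5 - 16 / N)%:E.
Proof.
apply: cvg_EFin; first by near=> k.
rewrite -[X in _ --> X]subr0; apply: cvgB; first exact: cvg_cst.
exact: trunc_err_cvg.
Unshelve. all: by end_near. Qed.

Lemma expectation_quad_sqr_ge :
  ((4 / 5 - 16 / N)%:E <= \int[eta]_x (quad c (tnth x) ^+ 2)%:E)%E.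
Proof.
have tq := tame_quad_sqr c.
suff : (Order.min (4 / 5 - 16 / N)%:E (4 / 5 - 16 / N)%:E <=
  \int[eta]_x (quad c (tnth x) ^+ 2)%:E)%E by rewrite minxx.
apply: (mine_limit_le bound_cvg bound_cvg) => k; rewrite minxx.
have [e0 em] := trunc_err_ge k.
have [rho [mrho rho0 nuE rho_qc]] := trunc_density k.
have q0 x : 0 <= quad c (tnth x) ^+ 2 by exact: sqr_ge0.
have mq : measurable_fun setT (fun x : Rn R n.+2 => (quad c (tnth x) ^+ 2)%:E).
  by apply/measurable_EFinP; exact: tq.1.
apply: le_trans (le_integral_trunc k mq (fun=> q0 _)).
rewrite -(trunc_RintegralE k tq q0) lee_fin.
exact: (Rintegral_quad_sqr_ge (trunc_env k) (trunc_perm k) (trunc_refl k) mrho rho0 nuE rho_qc cup c1 e0 em).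
Qed.

Lemma variance_quad_ge :
  (Order.min (variance eta (fun x => quad (@normalized_diag R n) (tnth x)))
     (4 / 5 - 16 / N)%:E <= variance eta (fun x => quad c (tnth x)))%E.
Proof.
rewrite !variance_quad diag_sum_normalized.
have td (d : 'I_n.+2 * 'I_n.+2 -> R) (s : R) :
    tame (fun x : Rn R n.+2 => (quad d (tnth x) - s) ^+ 2).
  exact: tame_quad_dev.
have m (d : 'I_n.+2 * 'I_n.+2 -> R) (s : R) : measurable_fun setT
    (fun x : Rn R n.+2 => ((quad d (tnth x) - s) ^+ 2)%:E).
  by apply/measurable_EFinP; exact: (td d s).1.
have q0 d s (x : Rn R n.+2) : 0 <= (quad d (tnth x) - s) ^+ 2 by exact: sqr_ge0.
apply: (mine_limit_le (cvg_integral_trunc (m _ _) (fun=> q0 _ _ _)) bound_cvg).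
move=> k; have [e0 em] := trunc_err_ge k.
have [rho [mrho rho0 nuE rho_qc]] := trunc_density k.
apply: le_trans (le_integral_trunc k (m _ _) (fun=> q0 _ _ _)).
rewrite -!(trunc_RintegralE k (td _ _) (q0 _ _)) -EFin_min lee_fin.
exact: (Rintegral_quad_dev_ge (trunc_env k) (trunc_perm k) (trunc_refl k) mrho rho0 nuE rho_qc cup c1 e0 em).
Qed.

End quadratic_bounds.

End truncation.

Theorem proposition4p10 (R : realType) :
  exists C1 C2 : R,
    forall (n : nat) (eta : probability (Rn R n) R) (f : mpoly.mpoly n R),
      (0 < n)%N ->
      Hn_invariant eta -> log_concave eta -> isotropic eta ->
      homogeneous 2 f -> coeff 2 f = 1 ->
      ((4 / 5 - C1 / n%:R)%:E <= 'E_eta[fun x => (evalRn f x ^+ 2)%R])%E /\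
      (Order.min 'V_eta[fun x => ((Num.sqrt n%:R)^-1 * norm2 x ^+ 2)%R]
                 (4 / 5 - C2 / n%:R)%:E <= 'V_eta[evalRn f])%E.
Proof.
(* The constant 16 comes from m22 >= n / (n + 16) >= 1 - 16 / n; it also makes the
   lower bounds negative when n = 1, where there is no second coordinate. *)
exists 16, 16 => n eta f n0 Heta Leta Ieta hf cf.
case: n n0 eta f Heta Leta Ieta hf cf => // -[|n] _ eta f Heta Leta Ieta hf cf.
  have neg : ((4 / 5 - 16 / 1%:R)%:E <= (0 : \bar R))%E by rewrite lee_fin; lra.
  split; apply: le_trans (_ : (0 <= _)%E).
  - exact: neg.
  - by apply: expectation_ge0 => x; exact: sqr_ge0.
  - by rewrite ge_min neg orbT.
  - exact: variance_ge0.
have [c [cup c1 fE]] := meval_quad hf cf.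
have -> : evalRn f = (fun x => quad c (tnth x)) by apply/funext.
split.
  by rewrite unlock; exact: expectation_quad_sqr_ge.
have -> : (fun x : Rn R n.+2 => (Num.sqrt n.+2%:R)^-1 * norm2 x ^+ 2) =
    (fun x => quad (@normalized_diag R n) (tnth x)).
  apply/funext => x; rewrite quad_normalized_diag /norm2 sqr_sqrtr//.
  by apply: sumr_ge0 => i _; exact: sqr_ge0.
exact: variance_quad_ge.
Qed.
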